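(* Assume the standing assumptions of the context. With $t_k=kh$, $h=T/K$, $\tau_k=T-t_k$ and $$\Phi_{t,s}=\exp\Big(\int_s^tf(T-u)\,du\Big),\quad \Phi_k=\Phi_{t_{k+1},t_k},\quad a_k=\int_{t_k}^{t_{k+1}}\Phi_{t_{k+1},s}\,g^2(T-s)\,ds,\quad b_k=\int_{t_k}^{t_{k+1}}\Phi_{t_{k+1},s}\,g(T-s)\,dW_s,$$ the exponential integrator $$\bar y_{k+1}=\Phi_k\,\bar y_k+a_k\,s_\theta(\tau_k,\bar y_k)+b_k,\qquad \bar y_0=y_0^{\mathcal N,\theta},$$ is a general strong scheme of order $\gamma=1$ for the SDE $$dy^{\mathcal N,\theta}_t=\big[f(T-t)y^{\mathcal N,\theta}_t+g^2(T-t)s_\theta(T-t,y^{\mathcal N,\theta}_t)\big]dt+g(T-t)\,dW_t,\qquad y_0^{\mathcal N,\theta}\sim\mathcal N(0,\sigma_T^2I_d).$$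
   Context: $W$ is a $d$-dimensional Wiener process; $(\mathcal F_t)$ is the filtration generated by the initial value and $W$; $\sigma_T^2=\int_0^Te^{-2\int_s^Tf(v)dv}g^2(s)\,ds$. Write $\mu(t,x)=f(T-t)x+g^2(T-t)s_\theta(T-t,x)$. Multi-indices $\alpha=(j_1,\dots,j_\ell)$, $j_i\in\{0,\dots,d\}$, together with the empty index $\nu$; $l(\alpha)=\ell$, $n(\alpha)$ = number of zero entries ($l(\nu)=n(\nu)=0$); $-\alpha$ (resp. $\alpha-$) deletes the first (resp. last) entry. $I_\nu[u]_{s,t}=u(t)$; for $\ell\ge1$, $I_\alpha[u]_{s,t}=\int_s^tI_{\alpha-}[u]_{s,r}\,dr$ if $j_\ell=0$ and $=\int_s^tI_{\alpha-}[u]_{s,r}\,dW^{(j_\ell)}_r$ if $j_\ell\ge1$, componentwise for vector-valued $u$; random vectors are regarded as time-constant integrands. With $L^0\varphi=\partial_t\varphi+\sum_i\mu_i\partial_{x_i}\varphi+\tfrac12g(T-t)^2\sum_i\partial_{x_i}^2\varphi$ and $L^r\varphi=g(T-t)\partial_{x_r}\varphi$ ($r=1,\dots,d$), the coefficient functions $f_\alpha$ ($\mathbb R^d$-valued) are $f_\nu(t,x)=x$, $f_\alpha=L^{j_1}f_{-\alpha}$ (componentwise). $\mathcal A_\gamma=\{\alpha:l(\alpha)+n(\alpha)\le2\gamma\text{ or }l(\alpha)=n(\alpha)=\gamma+\tfrac12\}$, $\mathcal B(\mathcal A)=\{\alpha\notin\mathcal A:-\alpha\in\mathcal A\}$. A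 general strong scheme of order $\gamma$ is an adapted scheme $\bar y_{k+1}=\bar y_k+\sum_{\alpha\in\mathcal A_\gamma\setminus\{\nu\}}I_\alpha[g_{\alpha,k}]_{t_k,t_{k+1}}+R_k$ where the integrands $g_{\alpha,k}$ are $\mathcal F_{t_k}$-measurable random vectors or, more generally, adapted processes on $[t_k,t_{k+1}]$, with $\mathbb E[\max_{0\le k\le K-1}\|g_{\alpha,k}-f_\alpha(t_k,\bar y_k)\|^2]\le Ch^{2\gamma-\phi(\alpha)}$ (for time-dependent integrands including a supremum over time in $[t_k,t_{k+1}]$), $\phi(\alpha)=2(l(\alpha)-1)$ if $l(\alpha)=n(\alpha)$ and $\phi(\alpha)=l(\alpha)+n(\alpha)-1$ otherwise, and $R_k=R_k^M+R_k^D$ with $\mathbb E[R_k^M\mid\mathcal F_{t_k}]=0$ a.s., $\max_k\mathbb E\|R_k^M\|^2\le C_Rh^{2\gamma+1}$, $\max_k\mathbb E\|R_k^D\|^2\le C_Rh^{2\gamma+2}$, with constants $C,C_R$ independent of $h$. Standing assumptions: $f,g:[0,\infty)\to\mathbb R$ deterministic and continuously differentiable, $|g|\le M_g$; $s_\theta$ continuous and smooth enough for the needed $f_\alpha$ to exist, with $\|s_\theta(t,x)-s_\theta(t,y)\|\le L_{s_\theta}\|x-y\|$ for $t\in[0,T]$; and there is $C_{\mathcal A}>0$ with $\|f_\alpha(t,x)-f_\alpha(t,y)\|\le C_{\mathcal A}\|x-y\|$, $\|f_\alpha(t,x)\|^2\le C_{\mathcal A}^2(1+\|x\|^2)$ for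 all $\alpha\in\mathcal A_1\cup\mathcal B(\mathcal A_1)$, $t\in[0,T]$, $x,y\in\mathbb R^d$. *)

(* Defs.v *)
From mathcomp Require Import all_boot all_order all_algebra.
From mathcomp Require Import all_classical all_reals all_analysis measurable_realfun.

Set Implicit Arguments.
Unset Strict Implicit.
Unset Printing Implicit Defensive.

Import Order.TTheory GRing.Theory Num.Theory.
Import numFieldNormedType.Exports.

Local Open Scope classical_set_scope.
Local Open Scope ring_scope.

(* The norm that the library puts on 'rV[R]_d is the sup norm, hence the
   explicit Euclidean norm. *)
Definition enorm (R : realType) (d : nat) (x : 'rV[R]_d) : R :=
  Num.sqrt (\sum_(i < d) x 0 i ^+ 2).

Section differentiation.
Context {R : realType}.
Implicit Types (D : set R) (f : R -> R) (t : R).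

(* Derivatives relative to D: one-sided at the endpoints of an interval, and
   blind to the values of f outside D. *)
Definition diff_quotient f t : R -> R := fun s => (s - t)^-1 * (f s - f t).

Definition derivable_on D f t : Prop :=
  cvg (diff_quotient f t s @[s --> within D t^']).

Definition derive_on D f t : R :=
  lim (diff_quotient f t s @[s --> within D t^']).

Definition C1_on D f : Prop :=
  (forall t, D t -> derivable_on D f t) /\
  {within D, continuous (derive_on D f)}.

End differentiation.

(* Entry 0 of a multi-index stands for dt, entry lift ord0 r for dW^r. *)
Definition multi_index (d : nat) := seq 'I_d.+1.

Section multi_indices.
Context {R : realType} {d : nat}.
Implicit Types (al : multi_index d) (gamma : R).

Definition nzero al : nat := count_mem ord0 al.

Definition A_set gamma : set (multi_index d) :=
  [set al | (size al + nzero al)%:R <= 2 * gamma \/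
            (size al = nzero al /\ (size al)%:R = gamma + 2^-1)].

Definition B_set (A : set (multi_index d)) : set (multi_index d) :=
  [set al | ~ A al /\ A (behead al)].

Definition phi_order al : nat :=
  if size al == nzero al then (2 * (size al).-1)%N
  else (size al + nzero al).-1.

End multi_indices.

(* Coefficient functions of dY = mu(t, Y) dt + sg(t) dW on [0, T]. *)
Section coefficients.
Context {R : realType} {d : nat}.
Variables (T : R) (mu : R -> 'rV[R]_d -> 'rV[R]_d) (sg : R -> R).
Implicit Types (phi : R -> 'rV[R]_d -> R) (j : 'I_d.+1).

Let e (i : 'I_d) : 'rV[R]_d := delta_mx 0 i.

Definition L_op j phi : R -> 'rV[R]_d -> R := fun t x =>
  match unlift ord0 j with
  | None =>
      derive_on `[0, T] (phi ^~ x) t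
      + \sum_(i < d) mu t x 0 i * 'D_(e i) (phi t) x
      + 2^-1 * sg t ^+ 2 * \sum_(i < d) 'D_(e i) ('D_(e i) (phi t)) x
  | Some r => sg t * 'D_(e r) (phi t) x
  end.

Definition L_op_exists j phi : Prop := forall t x, t \in `[0, T] ->
  match unlift ord0 j with
  | None =>
      derivable_on `[0, T] (phi ^~ x) t /\
      (forall i, derivable (phi t) x (e i)) /\
      (forall i, derivable ('D_(e i) (phi t)) x (e i))
  | Some r => derivable (phi t) x (e r)
  end.

Fixpoint coef (al : multi_index d) : R -> 'rV[R]_d -> 'rV[R]_d :=
  match al with
  | [::] => fun t x => x
  | j :: al' => fun t x =>
      \row_(c < d) L_op j (fun t' x' => coef al' t' x' 0 c) t x
  end.

Fixpoint coef_exists (al : multi_index d) : Prop :=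
  match al with
  | [::] => True
  | j :: al' => coef_exists al' /\
      forall c : 'I_d, L_op_exists j (fun t x => coef al' t x 0 c)
  end.

End coefficients.

Section probability.
Context {disp : measure_display} {Om : measurableType disp} {R : realType}.
Variable P : probability Om R.
Implicit Types (G H : set (set Om)) (X Y : Om -> R).

Definition measurable_wrt G X : Prop :=
  forall B : set R, measurable B -> G (X @^-1` B).

Definition indep_sigma G H : Prop :=
  forall A B, G A -> H B -> P (A `&` B) = (P A * P B)%E.

(* Y is a version of E[X | G]. *)
Definition is_cond_exp G X Y : Prop :=
  [/\ P.-integrable setT (EFin \o X),
      P.-integrable setT (EFin \o Y),
      measurable_wrt G Y &
      forall A, G A -> \int[P]_(w in A) Y w = \int[P]_(w in A) X w].

(* The library's normal_prob m 0 is the uniform law on [0, 1], not the Dirac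
   mass at m, so a null variance is treated apart. *)
Definition gauss_law (v : R) (B : set R) : \bar R :=
  if v == 0 then \d_(0 : R) B else normal_prob 0 (Num.sqrt v) B.

Context {d : nat}.
Implicit Type Z : Om -> 'rV[R]_d.

Definition random_vector Z : Prop :=
  forall c, measurable_fun setT (fun w => Z w 0 c).

(* Z has law N(0, v I_d). *)
Definition gaussian_vector Z (v : R) : Prop :=
  random_vector Z /\
  forall B : 'I_d -> set R, (forall c, measurable (B c)) ->
    P [set w | forall c, B c (Z w 0 c)] = (\prod_(c < d) gauss_law v (B c))%E.

Definition coord_events Z : set (set Om) :=
  [set A | exists c (B : set R), measurable B /\
           A = (fun w => Z w 0 c) @^-1` B].

Definition is_wiener (W : R -> Om -> 'rV[R]_d) : Prop :=
  [/\ forall t, 0 <= t -> random_vector (W t),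
      {ae P, forall w, W 0 w = 0},
      forall s t, 0 <= s -> s <= t ->
        gaussian_vector (fun w => W t w - W s w) (t - s),
      forall s t, 0 <= s -> s <= t ->
        indep_sigma <<s \bigcup_(u in `[0, s]) coord_events (W u) >>
                    <<s coord_events (fun w => W t w - W s w) >> &
      {ae P, forall w, forall c,
        {within `[0, +oo[, continuous (fun t => W t w 0 c)}}].

Definition filtration (y0 : Om -> 'rV[R]_d) (W : R -> Om -> 'rV[R]_d) (t : R) :
    set (set Om) :=
  <<s coord_events y0 `|` \bigcup_(u in `[0, t]) coord_events (W u) >>.

End probability.

Section ito.
Context {disp : measure_display} {Om : measurableType disp} {R : realType}.
Variables (P : probability Om R) (F : R -> set (set Om)).

Definition adapted_on (s t : R) (u : R -> Om -> R) : Prop :=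
  forall r, r \in `[s, t] -> measurable_wrt (F r) (u r).

Definition is_simple_process (s t : R) (n : nat) (p : nat -> R)
    (xi : nat -> Om -> R) : Prop :=
  [/\ p 0%N = s, p n = t, forall i, (i < n)%N -> p i <= p i.+1 &
      forall i, (i < n)%N -> measurable_wrt (F (p i)) (xi i) /\
        exists M : R, forall w, `|xi i w| <= M].

Definition simple_process (n : nat) (p : nat -> R) (xi : nat -> Om -> R)
    (r : R) (w : Om) : R :=
  \sum_(i < n) xi i w * \1_(`]p i, p i.+1]) r.

Definition simple_integral (B : R -> Om -> R) (n : nat) (p : nat -> R)
    (xi : nat -> Om -> R) (w : Om) : R :=
  \sum_(i < n) xi i w * (B (p i.+1) w - B (p i) w).

(* X is (a version, in L^2 of F t, of) the Ito integral of u from s to t with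
   respect to the real Brownian motion B: u is jointly measurable, adapted and
   approximated in L^2(ds x P) by bounded simple processes, whose integrals
   converge to X in L^2(P). *)
Definition is_ito (B u : R -> Om -> R) (s t : R) (X : Om -> R) : Prop :=
  [/\ measurable_fun (`[s, t] `*` setT) (fun rw : R * Om => u rw.1 rw.2),
      adapted_on s t u,
      measurable_wrt (F t) X &
      exists (n : nat -> nat) (p : nat -> nat -> R) (xi : nat -> nat -> Om -> R),
      [/\ forall m, is_simple_process s t (n m) (p m) (xi m),
          (\int[P]_w \int[lebesgue_measure]_(r in `[s, t])
             ((u r w - simple_process (n m) (p m) (xi m) r w) ^+ 2)%:E)%E
             @[m --> \oo] --> 0%E &
          (\int[P]_w ((X w - simple_integral B (n m) (p m) (xi m) w) ^+ 2)%:E)%E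
             @[m --> \oo] --> 0%E]].

Context {d : nat}.
Variable W : R -> Om -> 'rV[R]_d.

(* multiple_integral u s t al J: the process (J r), r in [s, t], is
   I_al[u]_{s,r}. *)
Inductive multiple_integral (u : R -> Om -> R) (s t : R) :
    multi_index d -> (R -> Om -> R) -> Prop :=
| MI_nil : multiple_integral u s t [::] u
| MI_time al J' J :
    multiple_integral u s t al J' ->
    {ae P, forall w,
      lebesgue_measure.-integrable `[s, t] (fun r => (J' r w)%:E) /\
      forall r, r \in `[s, t] ->
        J r w = \int[lebesgue_measure]_(v in `[s, r]) J' v w} ->
    multiple_integral u s t (rcons al ord0) J
| MI_wiener al (c : 'I_d) J' J :
    multiple_integral u s t al J' ->
    (forall r, r \in `[s, t] ->
       is_ito (fun v w => W v w 0 c) J' s r (J r)) ->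
    {ae P, forall w, {within `[s, t], continuous (J ^~ w)}} ->
    multiple_integral u s t (rcons al (lift ord0 c)) J.

End ito.

Definition grid (R : realType) (T : R) (K k : nat) : R := k%:R * (T / K%:R).

Section strong_scheme.
Context {disp : measure_display} {Om : measurableType disp} {R : realType}.
Context {d : nat}.
Variables (P : probability Om R) (F : R -> set (set Om)).
Variables (W : R -> Om -> 'rV[R]_d) (T : R).
Variables (mu : R -> 'rV[R]_d -> 'rV[R]_d) (sg : R -> R).

(* y K k is the k-th iterate of the scheme with K steps of size T / K for
   dY = mu(t, Y) dt + sg(t) dW. The family is indexed by K because the
   constants must not depend on the step size. Time-constant integrands that
   are F (t k)-measurable are particular adapted integrands Gk. *)
Definition general_strong_scheme (gamma : R) (y : nat -> nat -> Om -> 'rV[R]_d)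
    : Prop :=
  exists C C_R : R, forall K : nat, (0 < K)%N ->
  let h := T / K%:R in
  let t := grid T K in
  let A1 : set (multi_index d) := A_set gamma `\ [::] in
  (forall k c, (k <= K)%N ->
     measurable_wrt (F (t k)) (fun w => y K k w 0 c)) /\
  exists (Gk : multi_index d -> nat -> R -> Om -> 'rV[R]_d)
         (I : multi_index d -> nat -> R -> Om -> 'rV[R]_d)
         (RM RD : nat -> Om -> 'rV[R]_d),
  [/\ forall al k c, A1 al -> (k < K)%N ->
        adapted_on F (t k) (t k.+1) (fun r w => Gk al k r w 0 c) /\
        multiple_integral P F W (fun r w => Gk al k r w 0 c) (t k) (t k.+1) al
          (fun r w => I al k r w 0 c),
      forall al, A1 al ->
        let err : Om -> \bar R := fun w => \big[maxe/-oo%E]_(k < K) ereal_sup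
          [set (enorm (Gk al k r w - coef T mu sg al (t k) (y K k w)) ^+ 2)%:E
             | r in `[t k, t k.+1]] in
        measurable_fun setT err /\
        (\int[P]_w err w <= (C * h `^ (2 * gamma - (phi_order al)%:R))%:E)%E,
      forall k, (k < K)%N ->
        [/\ random_vector (RM k),
            forall c, is_cond_exp P (F (t k)) (fun w => RM k w 0 c) (cst 0) &
            (\int[P]_w (enorm (RM k w) ^+ 2)%:E
               <= (C_R * h `^ (2 * gamma + 1))%:E)%E],
      forall k, (k < K)%N ->
        random_vector (RD k) /\
        (\int[P]_w (enorm (RD k w) ^+ 2)%:E
           <= (C_R * h `^ (2 * gamma + 2))%:E)%E &
      forall k, (k < K)%N ->
        {ae P, forall w, y K k.+1 w =
           y K k w + \sum_(al \in A1) I al k (t k.+1) w + (RM k w + RD k w)}].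

End strong_scheme.

Section exponential_integrator.
Context {R : realType} {d : nat}.
Variables (f g : R -> R) (s_th : R -> 'rV[R]_d -> 'rV[R]_d) (T : R).

Definition sigma2 : R :=
  \int[lebesgue_measure]_(s in `[0, T])
    (expR (- 2 * \int[lebesgue_measure]_(v in `[s, T]) f v) * g s ^+ 2).

Definition drift (t : R) (x : 'rV[R]_d) : 'rV[R]_d :=
  f (T - t) *: x + g (T - t) ^+ 2 *: s_th (T - t) x.

Definition diffusion (t : R) : R := g (T - t).

(* Only used with s <= t. *)
Definition Phi (t s : R) : R :=
  expR (\int[lebesgue_measure]_(u in `[s, t]) f (T - u)).

Definition a_coef (K k : nat) : R :=
  \int[lebesgue_measure]_(s in `[grid T K k, grid T K k.+1])
    (Phi (grid T K k.+1) s * g (T - s) ^+ 2).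

Fixpoint exp_integrator (Om : Type) (K : nat) (y0 : Om -> 'rV[R]_d)
    (b : nat -> Om -> 'rV[R]_d) (k : nat) (w : Om) : 'rV[R]_d :=
  match k with
  | 0 => y0 w
  | k'.+1 =>
      let y := exp_integrator K y0 b k' w in
      Phi (grid T K k'.+1) (grid T K k') *: y
      + a_coef K k' *: s_th (T - grid T K k') y + b k' w
  end.

End exponential_integrator.

(* Main.v *)
From HB Require Import structures.
Require Import Defs.
From mathcomp Require Import all_boot all_order all_algebra.
From mathcomp Require Import all_classical all_reals all_analysis measurable_realfun.
From mathcomp Require Import ring lra.

Set Implicit Arguments.
Unset Strict Implicit.
Unset Printing Implicit Defensive.

Import Order.TTheory GRing.Theory Num.Theory.
Import numFieldNormedType.Exports.

Local Open Scope classical_set_scope.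
Local Open Scope ring_scope.

(** Take every integrand to be its coefficient function frozen at the left end
    of the step, G_al = f_al(t_k, y_k).  The integrand errors are then zero and
    the whole discrepancy between the exponential integrator and the scheme has
    to be absorbed by the remainder R_k.  This is what makes the proof
    elementary: integrand errors are measured by an expectation of a maximum
    over k, which would call for a maximal inequality, whereas remainders are
    measured by a maximum over k of expectations.

    For order 1 the indices are (0), (j) and (j1, j2), with coefficient
    functions mu, g(T - t) e_j and 0 (the noise is additive), so the frozen
    integrals add up to an Euler step ([sum_frozen_integral]).  Subtracting it
    from a step of the exponential integrator leaves
      R^M_k = b_k - g(T - t_k) (W_(t_k+1) - W_(t_k)),
      R^D_k = (Phi_k - 1 - h f(T - t_k)) y_k
              + (a_k - h g(T - t_k)^2) s_theta(T - t_k, y_k).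

    R^M_k is the Ito integral over the step of the deterministic function
    Phi_(t_k+1, s) g(T - s) - g(T - t_k), which is O(h) because f and g are C^1
    ([exponential_weight_estimates]).  Hence it has conditional mean 0 and
    second moment O(h^2 * h) ([is_ito_deterministic], [noise_increment]).  As
    an Ito integral is only known here as an L^2 limit of integrals of bounded
    simple processes, these two properties are first proved for discrete
    martingale transforms of Wiener increments ([transform_isometry],
    [transform_orthogonal]); they rest on the independence of an increment from
    the past of W and the initial value ([increment_indep]) and on two moments
    of the normal law.

    Both weights in R^D_k are O(h^2), so E|R^D_k|^2 = O(h^4) once E|y_k|^2 is
    bounded uniformly in k and in the number of steps
    ([drift_remainder_bound], [second_moment_bound]).  That bound is a discrete
    Gronwall argument: the cross term between the F_(t_k)-measurable part of
    the step and the noise b_k vanishes, so E|y_k+1|^2 exceeds E|y_k|^2 by at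
    most O(h) (1 + E|y_k|^2). *)

(** * Square-integrable random variables *)

Section square_integrable_variables.
Context {disp : measure_display} {Om : measurableType disp} {R : realType}.
Variable P : probability Om R.
Implicit Types X Y : Om -> R.

Definition square_integrable X : Prop :=
  measurable_fun setT X /\ P.-integrable setT (fun w => (X w ^+ 2)%:E).

(** The form of dominated integrability used throughout: real valued, on the
    whole space, with an everywhere pointwise bound. *)
Lemma dominated_integrable X Y : measurable_fun setT X ->
  (forall w, `|X w| <= Y w) -> P.-integrable setT (EFin \o Y) ->
  P.-integrable setT (EFin \o X).
Proof.
move=> mX XY iY; apply: le_integrable iY => //.
  exact/measurable_EFinP.
by move=> w _ /=; rewrite lee_fin (le_trans (XY w))// ler_norm.
Qed.

Lemma integrableD_fin X Y : P.-integrable setT (EFin \o X) ->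
  P.-integrable setT (EFin \o Y) -> P.-integrable setT (EFin \o (X \+ Y)).
Proof.
move=> iX iY; have := integrableD measurableT iX iY.
by apply: eq_integrable => // w _.
Qed.

Lemma integrableZ_fin c X : P.-integrable setT (EFin \o X) ->
  P.-integrable setT (EFin \o (fun w => c * X w)).
Proof.
move=> iX; have := integrableZl measurableT c iX.
by apply: eq_integrable => // w _.
Qed.

Lemma integrable_cst_fin c : P.-integrable setT (EFin \o (fun _ : Om => c)).
Proof. exact: finite_measure_integrable_cst. Qed.

Lemma integrable_sum_fin I (r : seq I) (X : I -> Om -> R) :
  (forall i, P.-integrable setT (EFin \o X i)) ->
  P.-integrable setT (EFin \o (fun w => \sum_(i <- r) X i w)).
Proof.
move=> iX; elim: r => [|i r ih].
  under [X in _ \o X]eq_fun do rewrite big_nil.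
  exact: integrable_cst_fin.
under [X in _ \o X]eq_fun do rewrite big_cons.
exact: integrableD_fin.
Qed.

Lemma Rintegral_sum I (r : seq I) (X : I -> Om -> R) :
  (forall i, P.-integrable setT (EFin \o X i)) ->
  \int[P]_w (\sum_(i <- r) X i w) = \sum_(i <- r) \int[P]_w X i w.
Proof.
move=> iX; elim: r => [|i r ih].
  under eq_Rintegral do rewrite big_nil.
  by rewrite big_nil Rintegral_cst// mul0r.
under eq_Rintegral do rewrite big_cons.
by rewrite RintegralD// ?ih ?big_cons//; exact: integrable_sum_fin.
Qed.

Lemma expectation_cst c : \int[P]_w (fun _ : Om => c) w = c.
Proof. by rewrite Rintegral_cst//= probability_setT mulr1. Qed.

Lemma sqint_mul X Y : square_integrable X -> square_integrable Y ->
  P.-integrable setT (EFin \o (fun w => X w * Y w)).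
Proof.
move=> [mX iX] [mY iY].
apply: (@dominated_integrable _ (fun w => X w ^+ 2 + Y w ^+ 2)).
- exact: measurable_funM.
- move=> w; rewrite normrM -(real_normK (num_real (X w))).
  rewrite -(real_normK (num_real (Y w))).
  have := sqr_ge0 (`|X w| - `|Y w|).
  have := normr_ge0 (X w); have := normr_ge0 (Y w).
  by nra.
- exact: integrableD_fin.
Qed.

Lemma sqint_cst c : square_integrable (fun=> c).
Proof. by split => //; exact: integrable_cst_fin. Qed.

Lemma sqint_bounded X M : measurable_fun setT X -> (forall w, `|X w| <= M) ->
  square_integrable X.
Proof.
move=> mX XM; split => //.
apply: (@dominated_integrable _ (fun=> M ^+ 2)).
- exact: measurable_funX.
- move=> w; rewrite normrX lerXn2r ?nnegrE//.
  exact: le_trans (XM w).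
- exact: integrable_cst_fin.
Qed.

Lemma sqint_integrable X : square_integrable X -> P.-integrable setT (EFin \o X).
Proof.
move=> sX; have := sqint_mul sX (sqint_cst 1).
by apply: eq_integrable => // w _ /=; rewrite mulr1.
Qed.

Lemma sqintZ c X : square_integrable X -> square_integrable (fun w => c * X w).
Proof.
move=> [mX iX]; split; first exact: measurable_funM.
have := @integrableZ_fin (c ^+ 2) _ iX.
by apply: eq_integrable => // w _ /=; rewrite exprMn.
Qed.

Lemma sqintD X Y : square_integrable X -> square_integrable Y ->
  square_integrable (fun w => X w + Y w).
Proof.
move=> sX sY; have [mX iX] := sX; have [mY iY] := sY.
split; first exact: measurable_funD.
have iXY := @integrableZ_fin 2 _ (sqint_mul sX sY).
have := integrableD_fin iX (integrableD_fin iY iXY).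
by apply: eq_integrable => // w _ /=; congr EFin; ring.
Qed.

Lemma sqintB X Y : square_integrable X -> square_integrable Y ->
  square_integrable (fun w => X w - Y w).
Proof.
move=> sX /(@sqintZ (-1)) sY; have := sqintD sX sY.
by congr square_integrable; apply/funext => w; rewrite mulN1r.
Qed.

Lemma sqint_mul_bounded (X Y : Om -> R) M : measurable_fun setT X ->
  (forall w, `|X w| <= M) -> square_integrable Y ->
  square_integrable (fun w => X w * Y w).
Proof.
move=> mX XM [mY iY]; split; first exact: measurable_funM.
apply: (@dominated_integrable _ (fun w => M ^+ 2 * Y w ^+ 2)).
- by apply: measurable_funX; exact: measurable_funM.
- move=> w; rewrite exprMn normrM [X in _ * X]ger0_norm ?sqr_ge0//.
  rewrite ler_wpM2r ?sqr_ge0// normrX lerXn2r ?nnegrE//.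
  exact: le_trans (XM w).
- exact: integrableZ_fin.
Qed.

Lemma expectation_sqr_ge0 X : 0 <= \int[P]_w (X w ^+ 2).
Proof. by apply: Rintegral_ge0 => w _; exact: sqr_ge0. Qed.

Lemma expectation_le X Y : P.-integrable setT (EFin \o X) ->
  P.-integrable setT (EFin \o Y) -> (forall w, X w <= Y w) ->
  \int[P]_w X w <= \int[P]_w Y w.
Proof. by move=> iX iY XY; apply: le_Rintegral. Qed.

Lemma expectation_sqrD_le X Y : square_integrable X -> square_integrable Y ->
  \int[P]_w ((X w + Y w) ^+ 2) <=
  2 * \int[P]_w (X w ^+ 2) + 2 * \int[P]_w (Y w ^+ 2).
Proof.
move=> sX sY; have [mX iX] := sX; have [mY iY] := sY.
rewrite -!RintegralZl// -RintegralD//; try exact: integrableZ_fin.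
apply: expectation_le.
- exact: (sqintD sX sY).2.
- by apply: integrableD_fin; exact: integrableZ_fin.
- by move=> w; have := sqr_ge0 (X w - Y w); nra.
Qed.

Lemma expectation_sqrD X Y : square_integrable X -> square_integrable Y ->
  \int[P]_w ((X w + Y w) ^+ 2) =
  \int[P]_w (X w ^+ 2) + 2 * \int[P]_w (X w * Y w) + \int[P]_w (Y w ^+ 2).
Proof.
move=> sX sY; have [mX iX] := sX; have [mY iY] := sY.
have iXY := sqint_mul sX sY.
rewrite -RintegralZl// -!RintegralD//; try exact: integrableZ_fin.
  by apply: eq_Rintegral => w _; ring.
by apply: integrableD_fin => //; exact: integrableZ_fin.
Qed.

(** The quadratic t |-> E (X + t Y)^2 is nonnegative; it is evaluated at its
    minimiser, the case E Y^2 = 0 being linear in t. *)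
Lemma cauchy_schwarz X Y : square_integrable X -> square_integrable Y ->
  (\int[P]_w (X w * Y w)) ^+ 2 <=
  \int[P]_w (X w ^+ 2) * \int[P]_w (Y w ^+ 2).
Proof.
move=> sX sY.
set a := \int[P]_w (X w ^+ 2); set b := \int[P]_w (Y w ^+ 2).
set c := \int[P]_w (X w * Y w).
have q t : 0 <= a + 2 * t * c + t ^+ 2 * b.
  have -> : a + 2 * t * c + t ^+ 2 * b = \int[P]_w ((X w + t * Y w) ^+ 2).
    rewrite expectation_sqrD//; last exact: sqintZ.
    congr (_ + _ + _).
      rewrite -mulrA; congr (_ * _); rewrite -RintegralZl//; last exact: sqint_mul.
      by apply: eq_Rintegral => w _; ring.
    rewrite -RintegralZl//; last by case: sY.
    by apply: eq_Rintegral => w _; ring.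
  exact: expectation_sqr_ge0.
have b0 : 0 <= b by exact: expectation_sqr_ge0.
have [b0'|b0'] := eqVneq b 0.
  rewrite b0' mulr0; have [->|c0] := eqVneq c 0; first by rewrite expr0n.
  (* at this t the affine function a + 2 t c takes the value -1 *)
  have := q (- (a + 1) / (2 * c)); rewrite b0' mulr0 addr0.
  have -> : 2 * (- (a + 1) / (2 * c)) * c = - (a + 1) by field.
  by lra.
have bp : 0 < b by rewrite lt_neqAle eq_sym b0' b0.
have := q (- c / b).
have -> : a + 2 * (- c / b) * c + (- c / b) ^+ 2 * b = (a * b - c ^+ 2) / b.
  by field.
by rewrite pmulr_lge0 ?invr_gt0// subr_ge0.
Qed.

End square_integrable_variables.

(** * Moments of the normal law *)

Section gaussian_moments.
Context {R : realType}.
Notation mu := (@lebesgue_measure R).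

(** The density is, almost everywhere, the Radon-Nikodym derivative, for which
    the change of variables is known. *)
Lemma ge0_integral_normal_prob (s : R) (f : R -> \bar R) :
  measurable_fun setT f -> (forall x, (0 <= f x)%E) ->
  (\int[normal_prob 0 s]_x f x = \int[mu]_x (f x * (normal_pdf 0 s x)%:E))%E.
Proof.
move=> mf f0; have dom := normal_prob_dominates (0 : R) s.
rewrite -(Radon_Nikodym_SigmaFinite.change_of_variables dom)//.
have mpdf : measurable_fun setT (fun x => (normal_pdf 0 s x)%:E).
  by apply/measurable_EFinP; exact: measurable_normal_pdf.
have iRN := Radon_Nikodym_SigmaFinite.f_integrable dom.
apply: ae_eq_integral => //.
- by apply: emeasurable_funM => //; exact: measurable_int iRN.
- exact: emeasurable_funM.
apply: ae_eqe_mul2l.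
apply: integral_ae_eq => //.
- move=> E _ mE.
  by rewrite -Radon_Nikodym_SigmaFinite.f_integral.
Qed.

Lemma integral_normal_prob_opp (s : R) (f : R -> \bar R) : s != 0 ->
  measurable_fun setT f -> (forall x, (0 <= f x)%E) ->
  (\int[normal_prob 0 s]_x f (- x)%R = \int[normal_prob 0 s]_x f x)%E.
Proof.
move=> s0 mf f0.
have mN : measurable_fun setT (-%R : R -> R) by exact: oppr_measurable.
rewrite !ge0_integral_normal_prob//; last exact: measurableT_comp.
transitivity (\int[pushforward mu (-%R : _ -> measurableTypeR R)]_x
   (f x * (normal_pdf 0 s x)%:E))%E; last first.
  by apply: eq_measure_integral => //= A mA _; exact: lebesgue_measureN.
rewrite ge0_integral_pushforward.
- apply: eq_integral => x _ /=; congr (_ * _%:E)%E.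
  by rewrite !normal_pdfE//; congr (_ * _); rewrite /normal_fun !subr0 sqrrN.
- exact: mN.
- exact: measurableT.
- apply: emeasurable_funM; first exact: mf.
  by apply/measurable_EFinP; exact: measurable_normal_pdf.
- by move=> x _; rewrite mule_ge0// lee_fin normal_pdf_ge0.
Qed.

(** The exact value s^2 would need an integration by parts; a bound linear in
    s^2 is enough for the isometry below to hold up to a constant.  It follows
    by comparing x^2 times the density of deviation s with the density of
    deviation 2 s, using y exp(-y) <= 1. *)
Lemma normal_second_moment (s : R) : s != 0 ->
  (\int[normal_prob 0 s]_x (x ^+ 2)%:E <= (8 * s ^+ 2)%:E)%E.
Proof.
move=> s0; rewrite ge0_integral_normal_prob//; first last.
- by move=> x; rewrite lee_fin sqr_ge0.
- by apply/measurable_EFinP; exact: exprn_measurable.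
have s2 : 0 < s ^+ 2 by rewrite exprn_even_gt0.
have s20 : 2 * s != 0 by rewrite mulf_neq0.
apply: (@le_trans _ _
    (\int[mu]_x ((8 * s ^+ 2)%:E * (normal_pdf 0 (2 * s) x)%:E))%E); last first.
  rewrite ge0_integralZl//.
  - by rewrite integral_normal_pdf mule1.
  - by apply/measurable_EFinP; exact: measurable_normal_pdf.
  - by move=> x _; rewrite lee_fin normal_pdf_ge0.
  - by rewrite lee_fin mulr_ge0// ltW.
apply: ge0_le_integral => //.
- by move=> x _; rewrite -EFinM lee_fin mulr_ge0 ?sqr_ge0 ?normal_pdf_ge0.
- apply/measurable_EFinP; apply: measurable_funM; first exact: exprn_measurable.
  exact: measurable_normal_pdf.
- apply/measurable_EFinP; apply: measurable_funM => //.
  exact: measurable_normal_pdf.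
move=> x _; rewrite -!EFinM lee_fin !normal_pdfE//.
have -> : normal_peak (2 * s) = 2^-1 * normal_peak s.
  rewrite /normal_peak exprMn -mulrA -mulrnAr sqrtrM ?sqr_ge0// sqrtr_sqr.
  by rewrite invfM ger0_norm// mulrnAr.
rewrite /normal_fun !subr0.
(* 3/8 = 1/2 - 1/8 is what remains of the exponent after the factor
   exp(- x^2 / (2 (2 s)^2)) has been taken out *)
set y := 3 / 8 * (x ^+ 2 / s ^+ 2).
have -> : - x ^+ 2 / (s ^+ 2 *+ 2) = - y + - x ^+ 2 / ((2 * s) ^+ 2 *+ 2).
  by rewrite /y; field.
rewrite expRD.
have yexp : y * expR (- y) <= 1.
  rewrite expRN ler_pdivrMr ?expR_gt0// mul1r.
  by rewrite (le_trans _ (expR_ge1Dx y))// lerDr.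
have xy : x ^+ 2 = 8 / 3 * s ^+ 2 * y by rewrite /y; field.
rewrite {1}xy.
set e1 := expR (- y) in yexp *; set e2 := expR _; set p := normal_peak s.
have pe : 0 <= p * e2 by rewrite mulr_ge0 ?normal_peak_ge0 ?expR_ge0.
rewrite (_ : 8 / 3 * s ^+ 2 * y * (p * (e1 * e2)) =
  8 / 3 * (y * e1) * (s ^+ 2 * (p * e2))); last by ring.
rewrite (_ : 8 * s ^+ 2 * (2^-1 * p * e2) = 4 * (s ^+ 2 * (p * e2))); last by field.
apply: ler_wpM2r; first by rewrite mulr_ge0// ltW.
by lra.
Qed.

Context {disp : measure_display} {Om : measurableType disp}.
Variables (P : probability Om R) (d : nat) (Z : Om -> 'rV[R]_d) (v : R).
Hypotheses (v0 : 0 <= v) (gZ : gaussian_vector P Z v).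
Variable c : 'I_d.

Let mZ : measurable_fun setT (fun w => Z w 0 c). Proof. by case: gZ. Qed.

Let gauss_lawT : gauss_law v setT = 1%E.
Proof.
rewrite /gauss_law; case: ifP => _; last exact: probability_setT.
by rewrite diracT.
Qed.

Let lawZ (B : set R) : measurable B ->
  P ((fun w => Z w 0 c) @^-1` B) = gauss_law v B.
Proof.
move=> mB; case: gZ => _ /(_ (fun i => if i == c then B else setT)) H.
transitivity (P [set w | forall i, (if i == c then B else setT) (Z w 0 i)]).
  congr (P _); apply/seteqP; split => [w Bw i|w /(_ c)]; last by rewrite eqxx.
  by case: eqP => // ->.
rewrite H; last by move=> i; case: ifP.
by rewrite (bigD1 c)//= eqxx big1 ?mule1// => i /negbTE ->.
Qed.

Let ge0_integral_law (f : R -> \bar R) :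
  measurable_fun setT f -> (forall x, (0 <= f x)%E) ->
  (\int[P]_w f (Z w 0%R c) =
   if v == 0%R then f 0%R else \int[normal_prob 0 (Num.sqrt v)]_x f x)%E.
Proof.
move=> mf f0.
pose X := (fun w => Z w 0 c) : Om -> measurableTypeR R.
transitivity (\int[pushforward P X]_x f x)%E.
  by rewrite ge0_integral_pushforward.
case: ifP => v0'.
  transitivity (\int[\d_ (0%R : measurableTypeR R)]_x f x)%E.
    apply: eq_measure_integral => A mA _.
    by rewrite [LHS]lawZ// /gauss_law v0'.
  by rewrite integral_dirac// diracT mul1e.
apply: eq_measure_integral => A mA _.
by rewrite [LHS]lawZ// /gauss_law v0'.
Qed.

Let second_moment : (\int[P]_w (Z w 0%R c ^+ 2)%:E <= (8 * v)%:E)%E.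
Proof.
rewrite (@ge0_integral_law (fun x => (x ^+ 2)%:E)).
- case: ifPn => [_|v0']; first by rewrite expr0n/= lee_fin mulr_ge0.
  have := @normal_second_moment (Num.sqrt v).
  by rewrite sqr_sqrtr//; apply; rewrite sqrtr_eq0 -ltNge lt_neqAle eq_sym v0' v0.
- by apply/measurable_EFinP; exact: exprn_measurable.
- by move=> x; rewrite lee_fin sqr_ge0.
Qed.

Lemma gaussian_sqint : square_integrable P (fun w => Z w 0 c).
Proof.
split => //; apply/integrableP; split.
  by apply/measurable_EFinP; exact: measurable_funX.
under eq_integral do rewrite gee0_abs ?lee_fin ?sqr_ge0//.
by rewrite (le_lt_trans second_moment)// ltry.
Qed.

Lemma gaussian_second_moment : \int[P]_w (Z w 0 c ^+ 2) <= 8 * v.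
Proof.
rewrite -lee_fin [leLHS]fineK; first exact: second_moment.
by apply: integrable_fin_num => //; case: gaussian_sqint.
Qed.

(** The positive and negative parts have the same integral, by symmetry of the
    law. *)
Lemma gaussian_mean : \int[P]_w Z w 0 c = 0.
Proof.
have fin : (\int[P]_w (Z w 0%R c)%:E)%E \is a fin_num.
  by apply: integrable_fin_num => //; exact: sqint_integrable gaussian_sqint.
rewrite /Rintegral integralE.
pose f (x : R) := maxe x%:E 0.
have mf : measurable_fun setT f.
  by apply: measurable_maxe => //; exact/measurable_EFinP.
have mfN : measurable_fun setT (fun x : R => f (- x)).
  by apply: measurableT_comp mf _; exact: oppr_measurable.
have f0 x : (0 <= f x)%E by rewrite le_max lexx orbT.
have -> : (\int[P]_x ((fun w => (Z w 0%R c)%:E)^\- x) =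
           \int[P]_w ((fun x : R => f (- x)%R) (Z w 0%R c)))%E.
  by apply: eq_integral => w _; rewrite funenegE /f EFinN.
have -> : (\int[P]_x ((fun w => (Z w 0%R c)%:E)^\+ x) =
           \int[P]_w (f (Z w 0%R c)))%E.
  by apply: eq_integral => w _; rewrite funeposE.
rewrite (ge0_integral_law mfN)// (ge0_integral_law mf)//.
case: ifPn => [_|v0']; first by rewrite oppr0 /f maxxx sube0.
rewrite integral_normal_prob_opp//; last first.
  by rewrite sqrtr_eq0 -ltNge lt_neqAle eq_sym v0' v0.
set I := integral _ _ _.
have Ige0 : (0 <= I)%E by exact: integral_ge0.
by case: I Ige0 => //= r _; rewrite subrr.
Qed.

End gaussian_moments.

(** * Measurability, independence and Wiener increments *)

Section measurability_wrt.
Context {disp : measure_display} {Om : measurableType disp} {R : realType}.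
Implicit Types (G H : set (set Om)) (X Y : Om -> R).

(** Measurability with respect to a generated sigma-algebra is measurability on
    the space carrying that sigma-algebra, so that the closure properties of
    measurable functions apply. *)
Lemma measurable_wrtE G X : measurable_wrt <<s G>> X <->
  @measurable_fun _ _ (g_sigma_algebraType G) R setT X.
Proof.
split=> [h _ B mB|h B mB]; first by rewrite setTI; exact: h.
by rewrite -[X in <<s _ >> X]setTI; exact: h.
Qed.

Lemma measurable_wrtS G H X : G `<=` H -> measurable_wrt G X ->
  measurable_wrt H X.
Proof. by move=> GH GX B mB; exact/GH/GX. Qed.

Lemma measurable_wrt_fun G X : <<s G>> `<=` measurable ->
  measurable_wrt <<s G>> X -> measurable_fun setT X.
Proof. by move=> GM GX _ B mB; rewrite setTI; apply/GM; exact: GX. Qed.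

Lemma sigma_generated_sub G : G `<=` measurable -> <<s G>> `<=` measurable.
Proof.
by move=> GM; apply: smallest_sub => //; exact: sigma_algebra_measurable.
Qed.

Lemma measurable_wrt_cst G c : measurable_wrt <<s G>> (fun _ : Om => c : R).
Proof. by apply/measurable_wrtE; exact: measurable_cst. Qed.

Lemma measurable_wrtB G X Y : measurable_wrt <<s G>> X ->
  measurable_wrt <<s G>> Y -> measurable_wrt <<s G>> (fun w => X w - Y w).
Proof.
by move=> /measurable_wrtE GX /measurable_wrtE GY;
  apply/measurable_wrtE; exact: measurable_funB.
Qed.

Lemma measurable_wrtD G X Y : measurable_wrt <<s G>> X ->
  measurable_wrt <<s G>> Y -> measurable_wrt <<s G>> (fun w => X w + Y w).
Proof.
by move=> /measurable_wrtE GX /measurable_wrtE GY;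
  apply/measurable_wrtE; exact: measurable_funD.
Qed.

Lemma measurable_wrtM G X Y : measurable_wrt <<s G>> X ->
  measurable_wrt <<s G>> Y -> measurable_wrt <<s G>> (fun w => X w * Y w).
Proof.
by move=> /measurable_wrtE GX /measurable_wrtE GY;
  apply/measurable_wrtE; exact: measurable_funM.
Qed.

Lemma measurable_wrtZ G c X : measurable_wrt <<s G>> X ->
  measurable_wrt <<s G>> (fun w => c * X w).
Proof. by move=> GX; apply: measurable_wrtM => //; exact: measurable_wrt_cst. Qed.

Lemma measurable_wrt_indic G A : <<s G>> A ->
  measurable_wrt <<s G>> (\1_A : Om -> R).
Proof.
move=> GA; apply/measurable_wrtE.
exact: (@measurable_indic _ (g_sigma_algebraType G)).
Qed.

Context {d : nat}.
Implicit Type Z : Om -> 'rV[R]_d.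

Lemma coord_events_measurable Z : random_vector Z ->
  coord_events Z `<=` measurable.
Proof.
by move=> mZ _ [c [B [mB ->]]]; rewrite -[X in measurable X]setTI; exact: mZ.
Qed.

Lemma coord_measurable_wrt G Z c : coord_events Z `<=` G ->
  measurable_wrt <<s G>> (fun w => Z w 0 c).
Proof.
by move=> ZG B mB; apply: sub_sigma_algebra; apply: ZG; exists c, B.
Qed.

End measurability_wrt.

Section independence.
Context {disp : measure_display} {Om : measurableType disp} {R : realType}.
Variable P : probability Om R.
Implicit Types G H : set (set Om).

(** The events A `&` B form an intersection-stable class generating the join of
    G1 and G2, and for fixed C the finite measures P (_ `&` C) and P C * P
    agree on it. *)
Lemma indep_sigma_join (G1 G2 H : set (set Om)) :
  <<s G1>> `<=` measurable -> <<s G2>> `<=` measurable -> H `<=` measurable ->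
  (forall A B C, <<s G1>> A -> <<s G2>> B -> H C ->
     P (A `&` B `&` C) = (P (A `&` B) * P C)%E) ->
  indep_sigma P <<s G1 `|` G2>> H.
Proof.
move=> mG1 mG2 mH ind A C GA HC.
pose G0 : set (set Om) :=
  [set D | exists A B, [/\ <<s G1>> A, <<s G2>> B & D = A `&` B]].
have G1T : <<s G1>> setT by exact: (@measurableT _ (g_sigma_algebraType G1)).
have G2T : <<s G2>> setT by exact: (@measurableT _ (g_sigma_algebraType G2)).
have mC : measurable C by exact: mH.
have pC : P C = (fine (P C))%:E by rewrite fineK// fin_num_measure.
have pC0 : 0 <= fine (P C) by rewrite fine_ge0.
have m2E D : mscale (NngNum pC0) P D = (P D * P C)%E by rewrite muleC [in RHS]pC.
suff : mrestr P mC A = mscale (NngNum pC0) P A by move=> E; rewrite -m2E; exact: E.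
apply: (@g_sigma_algebra_measure_unique _ _ _ G0 _ (fun=> setT)).
- move=> _ [A' [B' [GA' GB' ->]]].
  by apply: measurableI; [exact: mG1|exact: mG2].
- by move=> _; exists setT, setT; rewrite setIT.
- by rewrite bigcup_const//; exists 0%N.
- move=> _ _ [A1 [B1 [GA1 GB1 ->]]] [A2 [B2 [GA2 GB2 ->]]].
  exists (A1 `&` A2), (B1 `&` B2); rewrite setIACA; split => //.
  + exact: (@measurableI _ (g_sigma_algebraType G1)).
  + exact: (@measurableI _ (g_sigma_algebraType G2)).
- move=> _ [A' [B' [GA' GB' ->]]].
  by apply/esym; rewrite -/(P (_ `&` _)) [LHS]m2E; apply/esym; exact: ind.
- move=> _; change (P (setT `&` C) < +oo)%E.
  by rewrite -ge0_fin_numE// fin_num_measure//; exact: measurableI.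
- move: A GA; apply: smallest_sub; first exact: smallest_sigma_algebra.
  move=> B [GB|GB]; apply: sub_sigma_algebra.
  + by exists B, setT; rewrite setIT; split => //; exact: sub_sigma_algebra.
  + by exists setT, B; rewrite setTI; split => //; exact: sub_sigma_algebra.
Qed.

(** Independence says that the law of (X, Y) is the product of the laws of X
    and Y, and Fubini evaluates the integral of the product. *)
Lemma indep_expectationM G H (X Y : Om -> R) : indep_sigma P G H ->
  measurable_wrt G X -> measurable_wrt H Y ->
  P.-integrable setT (EFin \o X) -> P.-integrable setT (EFin \o Y) ->
  P.-integrable setT (EFin \o (fun w => X w * Y w)) ->
  \int[P]_w (X w * Y w) = \int[P]_w X w * \int[P]_w Y w.
Proof.
move=> ind GX HY iX iY iXY.
have mX : measurable_fun setT X by apply/measurable_EFinP; exact: measurable_int iX.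
have mY : measurable_fun setT Y by apply/measurable_EFinP; exact: measurable_int iY.
pose Xf : {mfun Om >-> R} := HB.pack X (isMeasurableFun.Build _ _ _ _ X mX).
pose Yf : {mfun Om >-> R} := HB.pack Y (isMeasurableFun.Build _ _ _ _ Y mY).
pose XY (w : Om) : R * R := (X w, Y w).
have mXY : measurable_fun setT XY by exact: measurable_fun_pair.
pose XYf : {mfun Om >-> (R * R)%type} :=
  HB.pack XY (isMeasurableFun.Build _ _ _ _ XY mXY).
pose f (z : R * R) : \bar R := (z.1 * z.2)%:E.
have mf : measurable_fun setT f.
  apply/measurable_EFinP; apply: measurable_funM.
    exact: measurable_fst.
  exact: measurable_snd.
have law (A : set (R * R)) : measurable A ->
    (distribution P Xf \x distribution P Yf)%E A = distribution P XYf A.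
  move=> mA; apply: product_measure_unique => // B C mB mC.
  rewrite /distribution /pushforward/=.
  by rewrite -ind//; [exact: GX|exact: HY].
have if1 : (distribution P XYf).-integrable setT f.
  exact: integrable_pushforward.
have if2 : (distribution P Xf \x distribution P Yf)%E.-integrable setT f.
  move/integrableP : if1 => [_ if1]; apply/integrableP; split => //.
  by rewrite (eq_measure_integral (distribution P XYf))// => A mA _; exact: law.
have E1 : (\int[P]_w (X w * Y w)%:E =
           \int[distribution P Xf \x distribution P Yf]_z f z)%E.
  transitivity (\int[distribution P XYf]_z f z)%E.
    by rewrite integral_distribution.
  by apply/esym/eq_measure_integral => A mA _; exact: law.
have mid : measurable_fun setT (fun x : R => x%:E).
  by apply/measurable_EFinP; exact: measurable_id.
have iX' : (distribution P Xf).-integrable setT (fun x : R => x%:E).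
  exact: integrable_pushforward.
have iY' : (distribution P Yf).-integrable setT (fun x : R => x%:E).
  exact: integrable_pushforward.
have EX : (\int[distribution P Xf]_x x%:E = (\int[P]_w X w)%:E)%E.
  rewrite [RHS]fineK; first exact: integral_distribution.
  exact: integrable_fin_num.
have EY : (\int[distribution P Yf]_x x%:E = (\int[P]_w Y w)%:E)%E.
  rewrite [RHS]fineK; first exact: integral_distribution.
  exact: integrable_fin_num.
have Fx x : (\int[distribution P Yf]_y f (x, y) = (\int[P]_w Y w)%:E * x%:E)%E.
  transitivity (\int[distribution P Yf]_y (x%:E * y%:E))%E.
    by apply: eq_integral => y _; rewrite -EFinM.
  by rewrite integralZl// EY muleC.
rewrite [LHS]/Rintegral E1 -integral12_prod_meas1//.
rewrite (eq_integral _ _ (fun x _ => Fx x)).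
by rewrite integralZl//= EX mulrC.
Qed.

End independence.

Section wiener.
Context {disp : measure_display} {Om : measurableType disp} {R : realType}.
Variables (P : probability Om R) (d : nat).
Variables (W : R -> Om -> 'rV[R]_d) (y0 : Om -> 'rV[R]_d).
Hypotheses (W_wiener : is_wiener P W) (y0_random : random_vector y0)
  (y0_indep : indep_sigma P <<s coord_events y0 >>
     <<s \bigcup_(t in `[0, +oo[) coord_events (W t) >>).
Notation F := (filtration y0 W).

Let W_random t : 0 <= t -> random_vector (W t).
Proof. by case: W_wiener => + _ _ _ _ => /[apply]. Qed.

Let W_past s := \bigcup_(u in `[0, s]) coord_events (W u).
Let W_all := \bigcup_(u in `[0, +oo[) coord_events (W u).

Let W_all_measurable : <<s W_all>> `<=` measurable.
Proof.
apply: sigma_generated_sub => A [u]; rewrite /= in_itv/= andbT => u0.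
by apply: coord_events_measurable; exact: W_random.
Qed.

Let W_past_all s : <<s W_past s>> `<=` <<s W_all>>.
Proof.
apply: sub_sigma_algebra2 => A [u]; rewrite /= in_itv/= => /andP[u0 us] uA.
by exists u => //=; rewrite in_itv/= u0.
Qed.

Lemma filtration_sub s t : s <= t -> F s `<=` F t.
Proof.
move=> st; apply: sub_sigma_algebra2 => A [?|[u]]; first by left.
rewrite /= in_itv/= => /andP[u0 us] uA; right; exists u => //=.
by rewrite in_itv/= u0 (le_trans us).
Qed.

Lemma filtration_measurable t : F t `<=` measurable.
Proof.
apply: sigma_generated_sub => A [|[u]].
  exact: coord_events_measurable.
rewrite /= in_itv/= => /andP[u0 _].
by apply: coord_events_measurable; exact: W_random.
Qed.

Lemma initial_adapted t c : measurable_wrt (F t) (fun w => y0 w 0 c).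
Proof. by apply: coord_measurable_wrt => A; left. Qed.

Lemma wiener_adapted s t c : 0 <= s -> s <= t ->
  measurable_wrt (F t) (fun w => W s w 0 c).
Proof.
move=> s0 st; apply: coord_measurable_wrt => A; right.
by exists s => //=; rewrite in_itv/= s0.
Qed.

(** For A determined by the initial value, B by the past of W and C by the
    increment: A is independent of B `&` C and of B, because these events
    depend on W only, and B is independent of C. *)
Lemma increment_indep s t : 0 <= s -> s <= t ->
  indep_sigma P (F s) <<s coord_events (fun w => W t w - W s w)>>.
Proof.
move=> s0 st; have t0 := le_trans s0 st.
have incr_all : <<s coord_events (fun w => W t w - W s w)>> `<=` <<s W_all>>.
  apply: smallest_sub; first exact: smallest_sigma_algebra.
  move=> _ [c [B [mB ->]]].
  have m u : 0 <= u -> measurable_wrt <<s W_all>> (fun w => W u w 0 c).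
    move=> u0; apply: coord_measurable_wrt => A uA.
    by exists u => //=; rewrite in_itv/= u0.
  have := measurable_wrtB (m _ t0) (m _ s0).
  rewrite (_ : (fun w => _) = (fun w => (W t w - W s w) 0 c)).
    exact.
  by apply/funext => w; rewrite !mxE.
apply: indep_sigma_join.
- by apply: sigma_generated_sub; exact: coord_events_measurable.
- by move=> A /W_past_all; exact: W_all_measurable.
- by move=> A /incr_all; exact: W_all_measurable.
move=> A B C yA WB WC.
have [_ _ _ + _] := W_wiener => /(_ s t s0 st) incr.
have WB' := W_past_all WB; have WC' := incr_all _ WC.
have WBC : <<s W_all>> (B `&` C).
  exact: (@measurableI _ (g_sigma_algebraType W_all)).
by rewrite -setIA y0_indep// incr// y0_indep// muleA.
Qed.

Section increment.
Variables (s t : R) (c : 'I_d).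
Hypotheses (s0 : 0 <= s) (st : s <= t).
Notation dW := (fun w => W t w 0 c - W s w 0 c).

Let dWE : (fun w => (W t w - W s w) 0 c) = dW.
Proof. by apply/funext => w; rewrite !mxE. Qed.

Let st0 : 0 <= t - s. Proof. by rewrite subr_ge0. Qed.

Let dW_gauss : gaussian_vector P (fun w => W t w - W s w) (t - s).
Proof. by case: W_wiener => _ _ + _ _; apply. Qed.

Lemma increment_sqint : square_integrable P dW.
Proof. by rewrite -dWE; exact: gaussian_sqint dW_gauss _. Qed.

Lemma increment_second_moment : \int[P]_w (dW w ^+ 2) <= 8 * (t - s).
Proof.
have := gaussian_second_moment st0 dW_gauss c.
by under eq_Rintegral do rewrite !mxE.
Qed.

Lemma expectationM_increment (X : Om -> R) : measurable_wrt (F s) X ->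
  square_integrable P X -> \int[P]_w (X w * dW w) = 0.
Proof.
move=> FX sX; rewrite (indep_expectationM (increment_indep s0 st) FX).
- have := gaussian_mean st0 dW_gauss c.
  by under eq_Rintegral do rewrite !mxE; move=> ->; rewrite mulr0.
- by rewrite -dWE; exact: coord_measurable_wrt.
- exact: sqint_integrable.
- exact/sqint_integrable/increment_sqint.
- exact: sqint_mul sX increment_sqint.
Qed.

(** The boundedness of X makes X dW square integrable before anything is known
    about its second moment. *)
Lemma expectation_sqrM_increment (X : Om -> R) M : measurable_wrt (F s) X ->
  (forall w, `|X w| <= M) ->
  square_integrable P (fun w => X w * dW w) /\
  \int[P]_w ((X w * dW w) ^+ 2) <= 8 * (t - s) * \int[P]_w (X w ^+ 2).
Proof.
move=> FX XM.
have mX := measurable_wrt_fun (@filtration_measurable s) FX.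
have sX : square_integrable P X by exact: sqint_bounded XM.
have [mdW idW] := increment_sqint.
have sXdW : square_integrable P (fun w => X w * dW w).
  exact: (sqint_mul_bounded mX XM increment_sqint).
split => //.
under eq_Rintegral do rewrite exprMn.
rewrite (indep_expectationM (increment_indep s0 st)).
- by rewrite mulrC ler_wpM2r ?expectation_sqr_ge0 ?increment_second_moment.
- exact: measurable_wrtM.
- by apply: measurable_wrtM; rewrite -dWE; exact: coord_measurable_wrt.
- by case: sX.
- by [].
- case: sXdW => _; apply: eq_integrable => // w _ /=.
  by rewrite exprMn.
Qed.

End increment.

End wiener.

(** * Ito integrals of deterministic functions *)

Section ito_integral.
Context {disp : measure_display} {Om : measurableType disp} {R : realType}.
Variables (P : probability Om R) (d : nat).
Variables (W : R -> Om -> 'rV[R]_d) (y0 : Om -> 'rV[R]_d).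
Hypotheses (W_wiener : is_wiener P W) (y0_random : random_vector y0)
  (y0_indep : indep_sigma P <<s coord_events y0 >>
     <<s \bigcup_(t in `[0, +oo[) coord_events (W t) >>).
Variable c : 'I_d.
Notation F := (filtration y0 W).
Notation B := (fun t w => W t w 0 c).
Notation mu := (@lebesgue_measure R).

Section transform_of_increments.
Variables (n : nat) (p : nat -> R) (eta : nat -> Om -> R).
Hypotheses (p0 : 0 <= p 0%N) (p_mono : forall i, (i < n)%N -> p i <= p i.+1)
  (eta_wrt : forall i, (i < n)%N -> measurable_wrt (F (p i)) (eta i))
  (eta_bounded : forall i, (i < n)%N -> exists M, forall w, `|eta i w| <= M).

(** A discrete stochastic integral against the chosen coordinate of W. *)
Definition martingale_transform (k : nat) (w : Om) : R :=
  \sum_(i < k) eta i w * (B (p i.+1) w - B (p i) w).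

Lemma partition_ge k : (k <= n)%N -> p 0%N <= p k.
Proof.
elim: k => // k ih kn.
by rewrite (le_trans (ih (ltnW kn)))// p_mono.
Qed.

Let p_ge0 k : (k <= n)%N -> 0 <= p k.
Proof. by move=> kn; rewrite (le_trans p0)// partition_ge. Qed.

Let transformS k : martingale_transform k.+1 =
  (fun w => martingale_transform k w + eta k w * (B (p k.+1) w - B (p k) w)).
Proof. by apply/funext => w; rewrite /martingale_transform big_ord_recr. Qed.

Let transform0 : martingale_transform 0 = (fun=> 0).
Proof. by apply/funext => w; rewrite /martingale_transform big_ord0. Qed.

Lemma transform_adapted k : (k <= n)%N ->
  measurable_wrt (F (p k)) (martingale_transform k).
Proof.
elim: k => [_|k ih kn]; first by rewrite transform0; exact: measurable_wrt_cst.
have Fk : F (p k) `<=` F (p k.+1) by apply: filtration_sub; exact: p_mono.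
rewrite transformS; apply: measurable_wrtD.
  by apply: (measurable_wrtS Fk); apply: ih; exact: ltnW.
apply: measurable_wrtM; first by apply: (measurable_wrtS Fk); exact: eta_wrt.
have pk0 := p_ge0 (ltnW kn).
by apply: measurable_wrtB; apply: wiener_adapted => //; [exact: p_ge0|exact: p_mono].
Qed.

(** Half of the Ito isometry: the cross terms vanish because the partial sum
    and its next coefficient are known at time p k. *)
Lemma transform_isometry k : (k <= n)%N ->
  square_integrable P (martingale_transform k) /\
  \int[P]_w (martingale_transform k w ^+ 2) <=
  8 * \sum_(i < k) (p i.+1 - p i) * \int[P]_w (eta i w ^+ 2).
Proof.
elim: k => [_|k ih kn].
  rewrite transform0; split; first exact: sqint_cst.
  by rewrite expr0n/= Rintegral_cst// mul0r big_ord0 mulr0.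
have [sM M2] := ih (ltnW kn).
have [C etaC] := eta_bounded kn.
have pk0 := p_ge0 (ltnW kn).
have [sdM dM2] := expectation_sqrM_increment W_wiener y0_random y0_indep c pk0
  (p_mono kn) (eta_wrt kn) etaC.
rewrite transformS; split; first exact: sqintD.
rewrite expectation_sqrD//.
have meta : measurable_fun setT (eta k).
  apply: measurable_wrt_fun (eta_wrt kn).
  exact: filtration_measurable W_wiener y0_random _.
have -> : \int[P]_w (martingale_transform k w *
    (eta k w * (B (p k.+1) w - B (p k) w))) = 0.
  under eq_Rintegral do rewrite mulrA [_ * eta k _]mulrC.
  apply: (expectationM_increment W_wiener y0_random y0_indep c pk0 (p_mono kn)).
    apply: measurable_wrtM; first exact: eta_wrt.
    exact: transform_adapted (ltnW kn).
  exact: sqint_mul_bounded etaC sM.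
rewrite mulr0 addr0 big_ord_recr/= mulrDr lerD//.
by rewrite (le_trans dM2)// -mulrA.
Qed.

Lemma transform_orthogonal (Y : Om -> R) k : (k <= n)%N ->
  measurable_wrt (F (p 0%N)) Y -> square_integrable P Y ->
  \int[P]_w (Y w * martingale_transform k w) = 0.
Proof.
move=> + FY sY; elim: k => [_|k ih kn].
  rewrite transform0; under eq_Rintegral do rewrite mulr0.
  by rewrite Rintegral_cst// mul0r.
have [sM _] := transform_isometry (ltnW kn).
have [C etaC] := eta_bounded kn.
have pk0 := p_ge0 (ltnW kn).
have [sdM _] := expectation_sqrM_increment W_wiener y0_random y0_indep c pk0
  (p_mono kn) (eta_wrt kn) etaC.
rewrite transformS.
under eq_Rintegral do rewrite mulrDr.
rewrite RintegralD//; try exact: sqint_mul.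
rewrite ih ?add0r; last exact: ltnW.
under eq_Rintegral do rewrite mulrA [_ * eta k _]mulrC.
have meta : measurable_fun setT (eta k).
  apply: measurable_wrt_fun (eta_wrt kn).
  exact: filtration_measurable W_wiener y0_random _.
apply: (expectationM_increment W_wiener y0_random y0_indep c pk0 (p_mono kn)).
  apply: measurable_wrtM; first exact: eta_wrt.
  apply: measurable_wrtS FY; apply: filtration_sub.
  exact: partition_ge (ltnW kn).
exact: sqint_mul_bounded etaC sY.
Qed.

End transform_of_increments.

(** The integral of a nonnegative function is a supremum over smaller simple
    functions, hence monotone whether or not the functions are measurable.  It
    is applied to a time integral depending on the outcome. *)
Lemma ge0_le_integral_any (f g : Om -> \bar R) : (forall w, (0 <= f w)%E) ->
  (forall w, (f w <= g w)%E) -> (\int[P]_w f w <= \int[P]_w g w)%E.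
Proof.
move=> f0 fg; have g0 w : (0 <= g w)%E by exact: le_trans (fg w).
rewrite !ge0_integralTE//; apply: ereal_sup_le => _ [h hf <-].
by exists h => // w; exact: le_trans (fg w).
Qed.

(** If u stays within delta of q, then the coefficients of a simple process
    approximating u are close to q in L^2 of time: at each time the squared
    distance is at most 2 (u - xi)^2 + 2 delta^2. *)
Lemma simple_process_dist (s t : R) (n : nat) (p : nat -> R)
    (xi : nat -> Om -> R) (u : R -> R) (q delta : R) (w : Om) :
  s <= t -> p 0%N = s -> p n = t -> (forall i, (i < n)%N -> p i <= p i.+1) ->
  measurable_fun `[s, t] u -> (forall r, r \in `[s, t] -> `|u r - q| <= delta) ->
  ((\sum_(i < n) (p i.+1 - p i) * (xi i w - q) ^+ 2)%:E <=
   2%:E * \int[mu]_(r in `[s, t]) ((u r - simple_process n p xi r w) ^+ 2)%:E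
   + (2 * delta ^+ 2 * (t - s))%:E)%E.
Proof.
move=> st p0 pn pS mu_u uq.
have pmono i j : (i <= j)%N -> (j <= n)%N -> p i <= p j.
  elim: j => [|j ih]; first by rewrite leqn0 => /eqP ->.
  rewrite leq_eqVlt => /predU1P[->//|ij] jn.
  by rewrite (le_trans (ih _ (ltnW jn)))// pS.
have mI i : measurable (`]p i, p i.+1] : set R) by exact: measurable_itv.
have mD : measurable (`[s, t] : set R) by exact: measurable_itv.
have msimple : measurable_fun `[s, t] (fun r => simple_process n p xi r w).
  by apply: measurable_sum => i; apply: measurable_funM.
have -> : ((\sum_(i < n) (p i.+1 - p i) * (xi i w - q) ^+ 2)%:E =
    \int[mu]_(r in `[s, t])
      (\sum_(i < n) (xi i w - q) ^+ 2 * \1_(`]p i, p i.+1]) r)%:E)%E.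
  under [RHS]eq_integral do rewrite -sumEFin.
  rewrite ge0_integral_sum//; first last.
  - by move=> i r _; rewrite lee_fin mulr_ge0 ?sqr_ge0.
  - move=> i; by apply/measurable_EFinP; apply: measurable_funM.
  rewrite -sumEFin; apply: eq_bigr => i _.
  under eq_integral do rewrite EFinM.
  rewrite ge0_integralZl//; first last.
  - by rewrite lee_fin sqr_ge0.
  - apply/measurable_EFinP.
    by apply: measurable_funTS; exact: measurable_indic.
  rewrite integral_indic//= setIidl; last first.
    move=> r /=; rewrite !in_itv/= => /andP[pr rp].
    rewrite -p0 -pn (le_trans _ (ltW pr)) ?pmono ?ltn_ord//; last exact: ltnW.
    by rewrite (le_trans rp)// pmono.
  rewrite [X in (_ * X)%E]lebesgue_measure_itv/= lte_fin.
  have [pp|pp] := ltP; first by rewrite -EFinB -EFinM mulrC.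
  have /eqP <- : p i == p i.+1 by rewrite eq_le pp pS.
  by rewrite subrr mul0r mule0.
have -> : ((2 * delta ^+ 2 * (t - s))%:E =
    \int[mu]_(r in `[s, t]) (2 * delta ^+ 2)%:E)%E.
  rewrite integral_cst// [X in (_ * X)%E]lebesgue_measure_itv/= lte_fin.
  have [ts|ts] := ltP; first by rewrite EFinM EFinB.
  have /eqP <- : s == t by rewrite eq_le ts st.
  by rewrite subrr mulr0 mule0.
have mdiff : measurable_fun `[s, t]
    (fun r => ((u r - simple_process n p xi r w) ^+ 2)%:E).
  by apply/measurable_EFinP; apply: measurable_funX; exact: measurable_funB.
rewrite -ge0_integralZl//; last by move=> r _; rewrite lee_fin sqr_ge0.
rewrite -ge0_integralD//; first last.
- by move=> r _; rewrite lee_fin mulr_ge0 ?sqr_ge0.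
- exact: measurable_funeM.
- by move=> r _; rewrite mule_ge0// lee_fin sqr_ge0.
apply: ge0_le_integral => //.
- move=> r _; rewrite lee_fin sumr_ge0// => i _.
  by rewrite mulr_ge0 ?sqr_ge0.
- apply/measurable_EFinP; apply: measurable_sum => i.
  by apply: measurable_funM.
- by apply: emeasurable_funD => //; exact: measurable_funeM.
move=> r sr; rewrite -EFinM -EFinD lee_fin.
have dpos : 0 <= 2 * delta ^+ 2 by rewrite mulr_ge0 ?sqr_ge0.
(* at most one of the intervals contains r, as p is nondecreasing *)
have [[i pir]|no] := pselect (exists i : 'I_n, r \in `]p i, p i.+1]).
  have other (j : 'I_n) : j != i -> \1_(`]p j, p j.+1]) r = 0 :> R.
    move=> ji; rewrite indicE memNset//= => prj.
    move: pir prj; rewrite /= !in_itv/= => /andP[a1 a2] /andP[b1 b2].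
    case: (ltngtP j i) => [lt|lt|/val_inj/eqP]; last by rewrite (negbTE ji).
      have := pmono j.+1 i lt (ltnW (ltn_ord i)).
      by move=> /(le_trans b2); rewrite leNgt a1.
    have := pmono i.+1 j lt (ltnW (ltn_ord j)).
    by move=> /(le_trans a2); rewrite leNgt b1.
  have one : \1_(`]p i, p i.+1]) r = 1 :> R by rewrite indicE mem_set.
  rewrite (bigD1 i)//= one big1 => [|j /other ->]; last by rewrite mulr0.
  rewrite /simple_process (bigD1 i)//= one [X in _ - (_ + X)]big1 => [|j /other ->];
    last by rewrite mulr0.
  rewrite !mulr1 !addr0.
  have uq2 : (u r - q) ^+ 2 <= delta ^+ 2.
    have := uq _ sr; rewrite -(real_normK (num_real (u r - q))) => h.
    by rewrite lerXn2r ?nnegrE// (le_trans _ h).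
  have := sqr_ge0 ((u r - xi i w) + (u r - q)).
  by nra.
rewrite big1 => [|i _].
  by rewrite addr_ge0// mulr_ge0 ?sqr_ge0.
rewrite indicE memNset ?mulr0//= => pir.
by apply: no; exists i.
Qed.

(** Subtracting q times the increment of W from an approximating simple integral
    gives the martingale transform with coefficients xi - q; the properties of
    transforms then pass to the L^2 limit.  With q = 0 this is about the
    integral itself, with q a value of u it is about the error made by freezing
    the integrand. *)
Lemma is_ito_deterministic (s t q delta : R) (u : R -> R) (X : Om -> R) :
  0 <= s -> s <= t -> (forall r, r \in `[s, t] -> `|u r - q| <= delta) ->
  is_ito P F B (fun r _ => u r) s t X ->
  let D w := X w - q * (B t w - B s w) in
  [/\ square_integrable P X,
      \int[P]_w (D w ^+ 2) <= 32 * delta ^+ 2 * (t - s) &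
      forall Y, measurable_wrt (F s) Y -> square_integrable P Y ->
        \int[P]_w (Y w * D w) = 0].
Proof.
move=> s0 st uq [mu' _ FX [n [p [xi [sim cvg_u cvg_X]]]]] D.
have mFt : forall r, F r `<=` measurable.
  exact: filtration_measurable W_wiener y0_random.
have mX : measurable_fun setT X by exact: (measurable_wrt_fun (mFt t) FX).
have mu_u : measurable_fun `[s, t] u.
  have [w0 _] : exists w0 : Om, True by exists point.
  apply: (@measurable_comp _ _ _ _ _ _ (`[s, t] `*` setT)
    (fun rw : R * Om => u rw.1) _ (fun r => (r, w0))) => //.
  - by apply: measurableX => //; exact: measurable_itv.
  - by move=> _ [r sr <-].
  - by apply: measurable_funTS; exact: pair2_measurable.
pose S m := simple_integral B (n m) (p m) (xi m).
pose M m w := S m w - q * (B t w - B s w).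
have approx (e : R) : 0 < e -> exists m,
    [/\ square_integrable P X, square_integrable P (S m),
    \int[P]_w ((X w - S m w) ^+ 2) <= e,
    \int[P]_w (M m w ^+ 2) <= 16 * (e + delta ^+ 2 * (t - s)) &
    forall Y, measurable_wrt (F s) Y -> square_integrable P Y ->
      \int[P]_w (Y w * M m w) = 0].
  move=> e0.
  have small (a : nat -> \bar R) : a @ \oo --> 0%E ->
      \forall m \near \oo, (a m < e%:E)%E.
    move=> a0; apply: (a0 [set x | (x < e%:E)%E]).
    by apply: open_ereal_lt'; rewrite lte_fin.
  have /filter_ex[m [um Xm]] : \forall m \near \oo, 
    (\int[P]_w \int[mu]_(r in `[s, t])
      ((u r - simple_process (n m) (p m) (xi m) r w) ^+ 2)%:E < e%:E)%E /\
    (\int[P]_w ((X w - S m w) ^+ 2)%:E < e%:E)%E.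
    by apply: filterS2 (small _ cvg_u) (small _ cvg_X) => m.
  exists m; have [p0 pn pS xiP] := sim m.
  pose eta i w := xi m i w - q.
  have eta_wrt i : (i < n m)%N -> measurable_wrt (F (p m i)) (eta i).
    move=> /xiP[Fxi _]; apply: measurable_wrtB => //.
    exact: measurable_wrt_cst.
  have eta_bnd i : (i < n m)%N -> exists C, forall w, `|eta i w| <= C.
    move=> /xiP[_ [C xiC]]; exists (C + `|q|) => w.
    by rewrite (le_trans (ler_normB _ _))// lerD2r.
  have xi_wrt i : (i < n m)%N -> measurable_wrt (F (p m i)) (xi m i).
    by move=> /xiP[].
  have xi_bnd i : (i < n m)%N -> exists C, forall w, `|xi m i w| <= C.
    by move=> /xiP[].
  have p0' : 0 <= p m 0%N by rewrite p0.
  have [sS _] := transform_isometry p0' pS xi_wrt xi_bnd (leqnn _).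
  have [sM M2] := transform_isometry p0' pS eta_wrt eta_bnd (leqnn _).
  have ME : martingale_transform (p m) eta (n m) = M m.
    apply/funext => w; rewrite /martingale_transform /M /S /simple_integral.
    under eq_bigr do rewrite /eta mulrBl.
    rewrite sumrB -mulr_sumr; congr (_ - _ * _).
    rewrite -(big_mkord xpredT (fun i => B (p m i.+1) w - B (p m i) w)).
    by rewrite (telescope_sumr (fun i => B (p m i) w))// p0 pn.
  have sXS : square_integrable P (fun w => X w - S m w).
    have mXS : measurable_fun setT (fun w => X w - S m w).
      by apply: measurable_funB => //; case: sS.
    split => //; apply/integrableP; split.
      by apply/measurable_EFinP; exact: measurable_funX.
    under eq_integral do rewrite gee0_abs ?lee_fin ?sqr_ge0//.
    by rewrite (lt_trans Xm)// ltry.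
  have sX : square_integrable P X.
    by have := sqintD sXS sS; congr square_integrable; apply/funext => w; rewrite subrK.
  split => //.
  - rewrite -lee_fin [leLHS]fineK; first exact: ltW.
    by apply: integrable_fin_num => //; case: sXS.
  - rewrite -ME (le_trans M2)//.
    rewrite (_ : 16 = 8 * 2); last by rewrite -natrM.
    rewrite -mulrA ler_pM2l//.
    have meta (i : 'I_(n m)) : square_integrable P (eta i).
      have [C etaC] := eta_bnd i (ltn_ord i).
      apply: sqint_bounded etaC.
      exact: (measurable_wrt_fun (mFt _) (eta_wrt i (ltn_ord i))).
    pose A w := \sum_(i < n m) (p m i.+1 - p m i) * eta i w ^+ 2.
    have iA : P.-integrable setT (EFin \o A).
      apply: integrable_sum_fin => i; apply: integrableZ_fin.
      by case: (meta i).
    have -> : \sum_(i < n m) (p m i.+1 - p m i) * \int[P]_w (eta i w ^+ 2) =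
        \int[P]_w A w.
      rewrite /A Rintegral_sum; last first.
        by move=> i; apply: integrableZ_fin; case: (meta i).
      by apply: eq_bigr => i _; rewrite RintegralZl//; case: (meta i).
    pose c0 := 2 * delta ^+ 2 * (t - s).
    (* A' is the part of A that the distance between u and the simple process
       has to account for; unlike that distance it is visibly measurable *)
    pose A' w := Num.max (2^-1 * (A w - c0)) 0.
    have mA : measurable_fun setT A by apply/measurable_EFinP; exact: measurable_int iA.
    have A0 w : 0 <= A w.
      by apply: sumr_ge0 => i _; rewrite mulr_ge0 ?sqr_ge0// subr_ge0 pS.
    have c00 : 0 <= c0 by rewrite mulr_ge0 ?subr_ge0// mulr_ge0 ?sqr_ge0.
    have A'0 w : 0 <= A' w by rewrite le_max lexx orbT.
    have iA' : P.-integrable setT (EFin \o A').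
      apply: (@dominated_integrable _ _ _ _ _ A) => //.
        apply: measurable_maxr => //; apply: measurable_funM => //.
        exact: measurable_funB.
      move=> w; rewrite ger0_norm// ge_max A0 andbT.
      by have := A0 w; lra.
    have A'e : \int[P]_w A' w <= e.
      rewrite -lee_fin [leLHS]fineK; last exact: integrable_fin_num.
      rewrite (le_trans _ (ltW um))//; apply: ge0_le_integral_any => w.
        by rewrite lee_fin.
      have := simple_process_dist (xi m) w st p0 pn pS mu_u uq.
      rewrite -/(A w) -/c0; set I := integral _ _ _.
      have I0 : (0 <= I)%E.
        by apply: integral_ge0 => r _; rewrite lee_fin sqr_ge0.
      case: I I0 => [x| |]; last 2 first.
      + by move=> _ _; rewrite leey.
      + by [].
      rewrite -EFinM -EFinD !lee_fin ge_max => -> h.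
      by rewrite andbT; lra.
    have : \int[P]_w A w <= \int[P]_w (2 * A' w + c0).
      apply: expectation_le => //.
        by apply: integrableD_fin; [exact: integrableZ_fin|exact: integrable_cst_fin].
      move=> w; have : 2^-1 * (A w - c0) <= A' w by rewrite le_max lexx.
      by lra.
    rewrite RintegralD//; [|exact: integrableZ_fin|exact: integrable_cst_fin].
    rewrite RintegralZl// expectation_cst /c0.
    by lra.
  - move=> Y FY sY; rewrite -ME.
    by apply: (transform_orthogonal p0' pS eta_wrt eta_bnd) => //; rewrite p0.
have [m [sX _ _ _ _]] := approx 1 ltr01.
have sdB : square_integrable P (fun w => q * (B t w - B s w)).
  by apply: sqintZ; exact: increment_sqint.
have sD : square_integrable P D by exact: sqintB.
have split_D m' : D = (fun w => (X w - S m' w) + M m' w).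
  by apply/funext => w; rewrite /D /M addrA subrK.
split => //.
- apply/ler_addgt0Pr => e e0.
  (* 34 = 2 + 2 * 16, from the two terms of the splitting of D *)
  have e34 : 0 < e / 34 by rewrite divr_gt0.
  have [m' [_ sS XS M2 _]] := approx _ e34.
  rewrite (split_D m') (le_trans (expectation_sqrD_le _ _))//.
  + exact: sqintB.
  + exact: sqintB.
  + by lra.
- move=> Y FY sY; set v := \int[P]_w (Y w * D w).
  suff : v ^+ 2 <= 0 by rewrite le_eqVlt ltNge sqr_ge0 orbF sqrf_eq0 => /eqP.
  apply/ler_addgt0Pr => e e0; rewrite add0r.
  set a := \int[P]_w (Y w ^+ 2).
  have a0 : 0 <= a by exact: expectation_sqr_ge0.
  have a1 : 0 < a + 1 by rewrite ltr_wpDl.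
  have ea : 0 < e / (a + 1) by rewrite divr_gt0.
  have [m' [_ sS XS _ orth]] := approx _ ea.
  have sXS : square_integrable P (fun w => X w - S m' w) by exact: sqintB.
  have sM : square_integrable P (M m') by exact: sqintB.
  have -> : v = \int[P]_w (Y w * (X w - S m' w)).
    rewrite /v (split_D m'); under eq_Rintegral do rewrite mulrDr.
    by rewrite RintegralD//; [rewrite orth// addr0|exact: sqint_mul..].
  rewrite (le_trans (cauchy_schwarz sY sXS))// -/a.
  rewrite (le_trans (ler_wpM2l a0 XS))// mulrCA ler_piMr ?(ltW e0)//.
  by rewrite ler_pdivrMr// mul1r lerDl.
Qed.

End ito_integral.

(** * Continuously differentiable functions and integral estimates *)

Section C1_functions.
Context {R : realType}.
Implicit Types (f : R -> R) (D : set R).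

Lemma derivable_on_near D f x : derivable_on D f x ->
  forall e, 0 < e -> exists2 r, 0 < r & forall s, `|x - s| < r -> s != x -> D s ->
    `|derive_on D f x - (s - x)^-1 * (f s - f x)| < e.
Proof.
move=> dfx e e0; have /cvgrPdist_lt /(_ e e0) := dfx.
move=> /(nbhs_ballP x)[r /= r0 h]; by exists r => // s xs sx Ds; exact: (h s).
Qed.

Lemma derivable_on_continuous D f : (forall t, D t -> derivable_on D f t) ->
  {within D, continuous f}.
Proof.
move=> df; apply/subspace_continuousP => x Dx.
apply/cvgrPdist_lt => e e0.
have [r r0 h] := derivable_on_near (df _ Dx) ltr01.
set l := derive_on D f x in h.
have l1 : 0 < `|l| + 1 by rewrite ltr_wpDl.
apply/(nbhs_ballP x); exists (Num.min r (e / (`|l| + 1))) => /=.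
  by rewrite lt_min r0 divr_gt0.
move=> s; rewrite /ball/= lt_min => /andP[xsr xse] Ds.
have [->|sx] := eqVneq s x; first by rewrite subrr normr0.
have sx0 : s - x != 0 by rewrite subr_eq0.
have := h s xsr sx Ds; set Q := _ * _ => lQ.
have -> : f x - f s = (x - s) * Q by rewrite /Q -opprB -(opprB s) mulNr mulVKf.
rewrite normrM; have : `|Q| <= `|l| + 1.
  have -> : Q = l - (l - Q) by rewrite opprB addrC subrK.
  by rewrite (le_trans (ler_normB _ _))// lerD2l ltW.
move=> Ql; apply: (@le_lt_trans _ _ (`|x - s| * (`|l| + 1))).
  by rewrite ler_wpM2l.
by rewrite -ltr_pdivlMr.
Qed.

(** At an interior point of the half-line the relative derivative is the
    ordinary one. *)
Lemma derivable_on_is_derive f x : 0 < x -> derivable_on `[0, +oo[ f x ->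
  is_derive x 1 f (derive_on `[0, +oo[ f x).
Proof.
move=> x0 dfx; set l := derive_on _ _ _.
have cv : (fun h : R => h^-1 *: ((f \o shift x) (h *: 1) - f x)) @ 0^' --> l.
  apply/cvgrPdist_lt => e e0.
  have [r r0 h] := derivable_on_near dfx e0.
  apply/(nbhs_ballP (0 : R)); exists (Num.min r x) => /=.
    by rewrite lt_min r0.
  move=> k; rewrite /ball/= sub0r normrN lt_min => /andP[kr kx] k0.
  have := h (k + x); rewrite opprD addrCA subrr addr0 normrN => /(_ kr).
  rewrite addrK [k *: 1]mulr1; apply.
    by rewrite -subr_eq0 addrK.
  rewrite /= in_itv/= andbT -lerBlDr sub0r.
  by have := ltW kx; rewrite ler_norml => /andP[].
by split; [apply/cvg_ex; exists l|exact/cvg_lim].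
Qed.

Lemma within_continuous_bounded f a b : a <= b ->
  {within `[a, b], continuous f} ->
  exists2 M, 0 <= M & forall t, t \in `[a, b] -> `|f t| <= M.
Proof.
move=> ab cf.
have [c1 _ h1] := EVT_max ab cf; have [c2 _ h2] := EVT_min ab cf.
exists (`|f c1| + `|f c2|) => [|t tab]; first exact: addr_ge0.
rewrite ler_norml; apply/andP; split.
  rewrite (le_trans _ (h2 _ tab))// lerNl (le_trans (ler_norm _))// normrN.
  by rewrite lerDr.
by rewrite (le_trans (h1 _ tab))// (le_trans (ler_norm _))// lerDl.
Qed.

Lemma C1_on_bounded_lipschitz f (T : R) : 0 <= T -> C1_on `[0, +oo[ f ->
  exists M L, [/\ 0 <= M, 0 <= L, forall t, t \in `[0, T] -> `|f t| <= M &
    forall s t, s \in `[0, T] -> t \in `[0, T] -> `|f s - f t| <= L * `|s - t|].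
Proof.
move=> T0 [df cdf].
have cf := derivable_on_continuous df.
have sub : `[0, T] `<=` `[0, +oo[%classic.
  by move=> r; rewrite /= !in_itv/= andbT => /andP[].
have [M M0 fM] := within_continuous_bounded T0 (continuous_subspaceW sub cf).
have [L L0 dfL] := within_continuous_bounded T0 (continuous_subspaceW sub cdf).
exists M, L; split => //.
suff lip s t : s \in `[0, T] -> t \in `[0, T] -> s <= t ->
    `|f t - f s| <= L * `|t - s|.
  move=> s t sT tT; have [st|ts] := leP s t; last by apply: lip => //; exact: ltW.
  by rewrite distrC [`|s - t|]distrC; exact: lip.
rewrite !in_itv/= => /andP[s0 sT] /andP[t0 tT] st.
have der x : x \in `]s, t[ -> is_derive x 1 f (derive_on `[0, +oo[ f x).
  rewrite in_itv/= => /andP[sx xt].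
  have x0 : 0 < x by exact: le_lt_trans sx.
  by apply: derivable_on_is_derive => //; apply: df; rewrite /= in_itv/= ltW.
have subst : `[s, t] `<=` `[0, +oo[%classic.
  by move=> r; rewrite /= !in_itv/= andbT => /andP[sr _]; exact: le_trans sr.
have [c ct ->] := MVT_segment st der (continuous_subspaceW subst cf).
rewrite normrM ler_wpM2r//; apply: dfL; move: ct; rewrite !in_itv/=.
by move=> /andP[sc ct]; rewrite (le_trans s0)//= (le_trans ct).
Qed.

End C1_functions.

Section integral_estimates.
Context {R : realType}.
Notation mu := (@lebesgue_measure R).
Implicit Types (phi : R -> R).

Lemma lipschitz_within_continuous phi L a b : 0 <= L ->
  (forall s t, s \in `[a, b] -> t \in `[a, b] -> `|phi s - phi t| <= L * `|s - t|) ->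
  {within `[a, b], continuous phi}.
Proof.
move=> L0 lip; apply/subspace_continuousP => x xab.
apply/cvgrPdist_lt => e e0.
have L1 : 0 < L + 1 by rewrite ltr_wpDl.
apply/(nbhs_ballP x); exists (e / (L + 1)) => /=; first by rewrite divr_gt0.
move=> s; rewrite /ball/= => xs sab.
rewrite (le_lt_trans (lip _ _ xab sab))//.
apply: (@le_lt_trans _ _ ((L + 1) * `|x - s|)).
  by rewrite ler_wpM2r// lerDl.
by rewrite mulrC -ltr_pdivlMr.
Qed.

Lemma continuous_itv_integrable phi a b : {within `[a, b], continuous phi} ->
  mu.-integrable `[a, b] (EFin \o phi).
Proof.
by move=> cphi; apply: continuous_compact_integrable => //; exact: segment_compact.
Qed.

Lemma Rintegral_itv_cst (a b q : R) : a <= b ->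
  \int[mu]_(u in `[a, b]) (fun=> q) u = (b - a) * q.
Proof.
move=> ab; rewrite Rintegral_cst//= lebesgue_measure_itv/= lte_fin.
have [lt|ge] := ltP; first by rewrite mulrC.
have /eqP -> : a == b by rewrite eq_le ge ab.
by rewrite subrr mul0r mulr0.
Qed.

Lemma Rintegral_near_cst phi a b q delta : a <= b ->
  {within `[a, b], continuous phi} ->
  (forall u, u \in `[a, b] -> `|phi u - q| <= delta) ->
  `|\int[mu]_(u in `[a, b]) phi u - (b - a) * q| <= (b - a) * delta.
Proof.
move=> ab cphi near.
have ccst c : {within `[a, b], continuous (fun=> c : R)}.
  by move=> x; exact: cvg_cst.
have iphi := continuous_itv_integrable cphi.
have icst c := continuous_itv_integrable (ccst c).
have upper : \int[mu]_(u in `[a, b]) phi u <= (b - a) * (q + delta).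
  rewrite -Rintegral_itv_cst//; apply: le_Rintegral => // u uab.
  by have := near u uab; rewrite ler_norml => /andP[_]; rewrite lerBlDl.
have lower : (b - a) * (q - delta) <= \int[mu]_(u in `[a, b]) phi u.
  rewrite -Rintegral_itv_cst//; apply: le_Rintegral => // u uab.
  by have := near u uab; rewrite ler_norml => /andP[]; rewrite lerBrDl.
by rewrite ler_norml; apply/andP; split; lra.
Qed.

(** 1 + x <= exp x applied at x and at - x gives x <= exp x - 1 <= x exp x. *)
Lemma expR_sub1_bound (x : R) : `|expR x - 1| <= `|x| * expR `|x|.
Proof.
have e1 : 1 + x <= expR x by exact: expR_ge1Dx.
have e2 : expR x - 1 <= x * expR x.
  have := expR_ge1Dx (- x); rewrite expRN => h.
  have : (1 - x) * expR x <= 1 by rewrite -ler_pdivlMr ?expR_gt0// mul1r.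
  by lra.
have [x0|x0] := leP 0 x.
  rewrite !ger0_norm//; last by lra.
have e3 : 1 <= expR (- x) by rewrite -[leLHS]expR0 ler_expR; lra.
have e4 : expR x <= 1 by rewrite -[leRHS]expR0 ler_expR ltW.
rewrite (ltr0_norm x0) ler0_norm; last by lra.
by nra.
Qed.

Lemma expR_sub1x_bound (x : R) : `|expR x - 1 - x| <= x ^+ 2 * expR `|x|.
Proof.
have e1 : 1 + x <= expR x by exact: expR_ge1Dx.
have e2 : expR x - 1 <= x * expR x.
  have := expR_ge1Dx (- x); rewrite expRN => h.
  have : (1 - x) * expR x <= 1 by rewrite -ler_pdivlMr ?expR_gt0// mul1r.
  by lra.
rewrite ger0_norm; last by lra.
apply: (@le_trans _ _ (x * (expR x - 1))); first by lra.
rewrite (le_trans (ler_norm _))// normrM -[x ^+ 2]ger0_norm ?sqr_ge0//.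
rewrite normrX expr2 -mulrA ler_wpM2l//; exact: expR_sub1_bound.
Qed.

End integral_estimates.

(** * The weights of the exponential integrator *)

Section exponential_weights.
Context {R : realType}.
Notation mu := (@lebesgue_measure R).
Variables (f g : R -> R) (T Mf Lf Mg Lg : R).
Hypotheses (Mf0 : 0 <= Mf) (Lf0 : 0 <= Lf) (Lg0 : 0 <= Lg).
Hypotheses (fM : forall t, t \in `[0, T] -> `|f t| <= Mf)
  (gM : forall t, t \in `[0, T] -> `|g t| <= Mg)
  (fL : forall s t, s \in `[0, T] -> t \in `[0, T] -> `|f s - f t| <= Lf * `|s - t|)
  (gL : forall s t, s \in `[0, T] -> t \in `[0, T] -> `|g s - g t| <= Lg * `|s - t|).

Let E := expR (T * Mf).
Let E0 : 0 <= E. Proof. exact: expR_ge0. Qed.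

Let rev_itv t : 0 <= t -> t <= T -> T - t \in `[0, T].
Proof. by move=> t0 tT; rewrite in_itv/= subr_ge0 tT lerBlDr lerDl. Qed.

Let reversed_lipschitz (k : R -> R) L s t :
  (forall s t, s \in `[0, T] -> t \in `[0, T] -> `|k s - k t| <= L * `|s - t|) ->
  0 <= s -> t <= T -> forall u v, u \in `[s, t] -> v \in `[s, t] ->
  `|k (T - u) - k (T - v)| <= L * `|u - v|.
Proof.
move=> kL s0 tT u v; rewrite !in_itv/= => /andP[su ut] /andP[sv vt].
have := kL (T - u) (T - v).
rewrite (_ : (T - u) - (T - v) = v - u) 1?[`|v - u|]distrC; last by ring.
by apply; apply: rev_itv; lra.
Qed.

Let reversed_continuous (k : R -> R) L s t : 0 <= L ->
  (forall s t, s \in `[0, T] -> t \in `[0, T] -> `|k s - k t| <= L * `|s - t|) ->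
  0 <= s -> t <= T -> {within `[s, t], continuous (fun u => k (T - u))}.
Proof.
move=> L0 kL s0 tT; apply: (lipschitz_within_continuous L0).
exact: reversed_lipschitz.
Qed.

Section step.
Variables (s t : R).
Hypotheses (s0 : 0 <= s) (st : s <= t) (tT : t <= T).
Let h := t - s.
Let h0 : 0 <= h. Proof. by rewrite subr_ge0. Qed.

Let f_cont r : s <= r -> {within `[r, t], continuous (fun u => f (T - u))}.
Proof.
by move=> sr; apply: reversed_continuous Lf0 fL _ tT; exact: le_trans sr.
Qed.

Let exponent r := \int[mu]_(u in `[r, t]) f (T - u).

Let exponent_bound r : s <= r -> r <= t -> `|exponent r| <= h * Mf.
Proof.
move=> sr rt.
have := @Rintegral_near_cst _ (fun u => f (T - u)) r t 0 Mf rt (f_cont sr).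
rewrite mulr0 subr0 => /(_ _)/le_trans; apply.
  move=> u; rewrite in_itv/= subr0 => /andP[ru ut].
  apply: fM; apply: rev_itv; [|exact: le_trans tT].
  by rewrite (le_trans s0)// (le_trans sr).
by rewrite ler_wpM2r// lerB.
Qed.

Let h_le_T : h <= T. Proof. rewrite lerBlDr (le_trans tT)// lerDl. exact: s0. Qed.

Let exp_exponent_bound r : s <= r -> r <= t -> expR `|exponent r| <= E.
Proof.
move=> sr rt; rewrite ler_expR (le_trans (exponent_bound sr rt))//.
by rewrite ler_wpM2r.
Qed.

Lemma Phi_sub1_bound r : s <= r -> r <= t ->
  `|Phi f T t r - 1| <= Mf * E * (t - s).
Proof.
move=> sr rt; rewrite (le_trans (expR_sub1_bound _))// -/(exponent r).
rewrite (_ : Mf * E * (t - s) = (h * Mf) * E); last by rewrite /h; ring.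
by rewrite ler_pM ?exponent_bound ?exp_exponent_bound ?expR_ge0.
Qed.

(** The exponent differs from (t - s) f(T - s) by O((t - s)^2) because f is
    Lipschitz, and exp x from 1 + x by O(x^2). *)
Lemma Phi_sub1x_bound :
  `|Phi f T t s - 1 - (t - s) * f (T - s)| <= (Mf ^+ 2 * E + Lf) * (t - s) ^+ 2.
Proof.
have lin : `|exponent s - h * f (T - s)| <= h * (Lf * h).
  apply: Rintegral_near_cst => //; first exact: f_cont.
  move=> u ust; apply: (@le_trans _ _ (Lf * `|u - s|)).
    apply: (reversed_lipschitz fL s0 tT) => //.
    by rewrite in_itv/= lexx.
  rewrite ler_wpM2l//; move: ust; rewrite in_itv/= => /andP[su ut].
  by rewrite ger0_norm ?subr_ge0// lerB.
have quad : `|expR (exponent s) - 1 - exponent s| <= (h * Mf) ^+ 2 * E.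
  rewrite (le_trans (expR_sub1x_bound _))//.
  rewrite ler_pM ?sqr_ge0 ?expR_ge0 ?exp_exponent_bound//.
  rewrite -[leLHS]ger0_norm ?sqr_ge0// normrX lerXn2r ?nnegrE//.
    by rewrite mulr_ge0.
  exact: exponent_bound.
rewrite (_ : Phi f T t s - 1 - (t - s) * f (T - s) =
  (expR (exponent s) - 1 - exponent s) + (exponent s - h * f (T - s))); last first.
  by rewrite /Phi -/(exponent s) /h; ring.
rewrite (le_trans (ler_normD _ _))//.
rewrite (_ : (Mf ^+ 2 * E + Lf) * (t - s) ^+ 2 = (h * Mf) ^+ 2 * E + h * (Lf * h));
  last by rewrite /h; ring.
exact: lerD.
Qed.

Lemma Phi_continuous : {within `[s, t], continuous (fun r => Phi f T t r)}.
Proof.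
move=> r; apply: (@continuous_comp (subspace `[s, t]) R R exponent expR);
  last exact: continuous_expR.
move: r; apply: (lipschitz_within_continuous Mf0).
suff lip u v : u \in `[s, t] -> v \in `[s, t] -> u <= v ->
    `|exponent u - exponent v| <= Mf * `|u - v|.
  move=> u v us vs; have [uv|vu] := leP u v; first exact: lip.
  by rewrite distrC [`|u - v|]distrC; apply: lip => //; exact: ltW.
rewrite !in_itv/= => /andP[su ut] /andP[sv vt] uv.
have iu := continuous_itv_integrable (f_cont su).
have -> : exponent u - exponent v = \int[mu]_(x in `[u, v]) f (T - x).
  have := @Rintegral_itvB _ (fun u => f (T - u)) (BLeft u) (BRight t) v iu uv vt.
  rewrite Rintegral_itv_obnd_cbnd => [e|]; first by rewrite /exponent -e; ring.
  apply: integrableS iu => //.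
  by move=> x; rewrite /= !in_itv/= => /andP[vx ->]; rewrite (le_trans uv)// ltW.
have vT : v <= T by exact: le_trans tT.
have u0 : 0 <= u by exact: le_trans su.
have := @Rintegral_near_cst _ (fun u => f (T - u)) u v 0 Mf uv
  (reversed_continuous Lf0 fL u0 vT).
rewrite mulr0 subr0 => /(_ _)/le_trans; apply.
  move=> x; rewrite in_itv/= subr0 => /andP[ux xv].
  by apply: fM; apply: rev_itv; [exact: le_trans ux|exact: le_trans vT].
by rewrite mulrC distrC ger0_norm ?subr_ge0.
Qed.

Let g_bound r : s <= r -> r <= t -> `|g (T - r)| <= Mg.
Proof.
by move=> sr rt; apply: gM; apply: rev_itv; [exact: le_trans sr|exact: le_trans tT].
Qed.

Let g_incr r : s <= r -> r <= t -> `|g (T - r) - g (T - s)| <= Lg * (t - s).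
Proof.
move=> sr rt; apply: (@le_trans _ _ (Lg * `|r - s|)).
  by apply: (reversed_lipschitz gL s0 tT); rewrite in_itv/= ?lexx ?sr.
by rewrite ler_wpM2l// ger0_norm ?subr_ge0// lerB.
Qed.

Lemma Phi_diffusion_bound r : s <= r -> r <= t ->
  `|Phi f T t r * g (T - r) - g (T - s)| <= (Mf * E * Mg + Lg) * (t - s).
Proof.
move=> sr rt.
rewrite (_ : _ - _ = (Phi f T t r - 1) * g (T - r) + (g (T - r) - g (T - s)));
  last by ring.
rewrite (le_trans (ler_normD _ _))// normrM mulrDl lerD ?g_incr//.
by rewrite mulrAC ler_pM ?Phi_sub1_bound ?g_bound.
Qed.

Lemma Phi_diffusion2_bound r : s <= r -> r <= t ->
  `|Phi f T t r * g (T - r) ^+ 2 - g (T - s) ^+ 2| <=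
  (Mf * E * Mg ^+ 2 + 2 * Mg * Lg) * (t - s).
Proof.
move=> sr rt.
rewrite (_ : _ - _ = (Phi f T t r - 1) * g (T - r) ^+ 2 +
  (g (T - r) + g (T - s)) * (g (T - r) - g (T - s))); last by ring.
rewrite (le_trans (ler_normD _ _))// !normrM mulrDl lerD//.
  by rewrite mulrAC ler_pM ?Phi_sub1_bound// ler_pM ?g_bound.
rewrite -mulrA ler_pM ?g_incr// (le_trans (ler_normD _ _))//.
by rewrite mulr2n mulrDl mul1r lerD ?g_bound.
Qed.

(** The integrand is within O(t - s) of its frozen value, and the interval has
    length t - s. *)
Lemma drift_weight_bound :
  `|\int[mu]_(r in `[s, t]) (Phi f T t r * g (T - r) ^+ 2) - (t - s) * g (T - s) ^+ 2|
  <= (Mf * E * Mg ^+ 2 + 2 * Mg * Lg) * (t - s) ^+ 2.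
Proof.
rewrite (_ : (_ + _) * _ = (t - s) * ((Mf * E * Mg ^+ 2 + 2 * Mg * Lg) * (t - s)));
  last by ring.
apply: Rintegral_near_cst => //.
  move=> r; apply: cvgM; first exact: Phi_continuous.
  have cg := reversed_continuous Lg0 gL s0 tT.
  by apply: cvgM; exact: cg.
move=> r; rewrite in_itv/= => /andP[sr rt]; exact: Phi_diffusion2_bound.
Qed.

End step.

End exponential_weights.

Section exponential_weights_C1.
Context {R : realType}.
Notation mu := (@lebesgue_measure R).

(** All that the convergence analysis uses about f and g, with one constant that
    serves every step of every grid. *)
Lemma exponential_weight_estimates (f g : R -> R) (T : R) : 0 <= T ->
  C1_on `[0, +oo[ f -> C1_on `[0, +oo[ g ->
  exists C, 0 <= C /\ forall s t, 0 <= s -> s <= t -> t <= T ->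
  [/\ `|Phi f T t s - 1| <= C * (t - s),
      `|Phi f T t s - 1 - (t - s) * f (T - s)| <= C * (t - s) ^+ 2,
      `|\int[mu]_(r in `[s, t]) (Phi f T t r * g (T - r) ^+ 2)
        - (t - s) * g (T - s) ^+ 2| <= C * (t - s) ^+ 2,
      `|g (T - s)| <= C &
      forall r, r \in `[s, t] ->
        `|Phi f T t r * g (T - r) - g (T - s)| <= C * (t - s)].
Proof.
move=> T0 fC1 gC1.
have [Mf [Lf [Mf0 Lf0 fM fL]]] := C1_on_bounded_lipschitz T0 fC1.
have [Mg [Lg [Mg0 Lg0 gM gL]]] := C1_on_bounded_lipschitz T0 gC1.
set E := expR (T * Mf); have E0 : 0 <= E by exact: expR_ge0.
pose C1 := Mf * E; pose C2 := Mf ^+ 2 * E + Lf.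
pose C3 := Mf * E * Mg ^+ 2 + 2 * Mg * Lg; pose C4 := Mf * E * Mg + Lg.
have C10 : 0 <= C1 by rewrite mulr_ge0.
have C20 : 0 <= C2 by rewrite addr_ge0// mulr_ge0// sqr_ge0.
have C30 : 0 <= C3.
  by apply: addr_ge0; apply: mulr_ge0 => //; rewrite ?sqr_ge0 ?mulr_ge0.
have C40 : 0 <= C4.
  by apply: addr_ge0 => //; apply: mulr_ge0 => //; exact: mulr_ge0.
exists (C1 + C2 + C3 + C4 + Mg); split; first by do 4 apply: addr_ge0 => //.
move=> s t s0 st tT.
have h0 : 0 <= t - s by rewrite subr_ge0.
have h20 : 0 <= (t - s) ^+ 2 by rewrite sqr_ge0.
split.
- apply: le_trans (Phi_sub1_bound Mf0 Lf0 fM fL s0 tT (lexx s) st) _.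
  by rewrite ler_wpM2r// -/E -/C1; lra.
- apply: le_trans (Phi_sub1x_bound Mf0 Lf0 fM fL s0 st tT) _.
  by rewrite ler_wpM2r// -/E -/C2; lra.
- apply: le_trans (drift_weight_bound Mf0 Lf0 Lg0 fM gM fL gL s0 st tT) _.
  by rewrite ler_wpM2r// -/E -/C3; lra.
- apply: (@le_trans _ _ Mg); last by lra.
  by apply: gM; rewrite in_itv/=; lra.
- move=> r; rewrite in_itv/= => /andP[sr rt].
  apply: le_trans (Phi_diffusion_bound Mf0 Lf0 Lg0 fM gM fL gL s0 st tT sr rt) _.
  by rewrite ler_wpM2r// -/E -/C4; lra.
Qed.

End exponential_weights_C1.

(** * Lipschitz vector fields *)

Section vector_functions.
Context {R : realType} {d : nat}.
Implicit Types x y : 'rV[R]_d.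

Lemma enorm_sq x : enorm x ^+ 2 = \sum_(c < d) x 0 c ^+ 2.
Proof. by rewrite sqr_sqrtr// sumr_ge0// => c _; exact: sqr_ge0. Qed.

Lemma lipschitz_sq x y L : enorm x <= L * enorm y ->
  \sum_(c < d) x 0 c ^+ 2 <= L ^+ 2 * \sum_(c < d) y 0 c ^+ 2.
Proof.
move=> xy; rewrite -!enorm_sq -exprMn.
have x0 : 0 <= enorm x by exact: sqrtr_ge0.
by rewrite lerXn2r// nnegrE// (le_trans x0).
Qed.

Lemma lipschitz_coord_sq x y L c : enorm x <= L * enorm y ->
  x 0 c ^+ 2 <= L ^+ 2 * \sum_(i < d) y 0 i ^+ 2.
Proof.
move=> /lipschitz_sq; apply: le_trans.
by rewrite (bigD1 c)//= lerDl sumr_ge0// => i _; exact: sqr_ge0.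
Qed.

(** The Lipschitz condition compares s t x with s t 0, which is bounded on
    [0, T] by continuity.  Growth is stated on sums of squares of coordinates,
    which add up under expectation. *)
Lemma linear_growth (T : R) (s : R -> 'rV[R]_d -> 'rV[R]_d) (L : R) : 0 <= T ->
  {within `[0, T] `*` setT, continuous (fun tx : R * 'rV[R]_d => s tx.1 tx.2)} ->
  (forall t x y, t \in `[0, T] -> enorm (s t x - s t y) <= L * enorm (x - y)) ->
  exists2 S, 0 <= S & forall t x, t \in `[0, T] ->
    \sum_(c < d) s t x 0 c ^+ 2 <= S * (1 + \sum_(c < d) x 0 c ^+ 2).
Proof.
move=> T0 cs lip.
have bound (c : 'I_d) : exists M, forall t, t \in `[0, T] -> `|s t 0 0 c| <= M.
  have ct : {within `[0, T], continuous (fun t => s t 0 0 c)}.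
    apply/subspace_continuousP => t tT.
    have /subspace_continuousP/(_ (t, 0)) := cs.
    move=> /(_ (conj tT I)) st.
    apply: (cvg_comp (fun t => s t 0) (fun x : 'rV[R]_d => x 0 c));
      last exact: coord_continuous.
    apply: (cvg_comp (fun t => (t, 0 : 'rV[R]_d))
      (fun tx : R * 'rV[R]_d => s tx.1 tx.2) _ st).
    move=> A; rewrite /within/= => -[[B1 B2] [B1t B20] BA].
    apply: filterS B1t => r B1r rT.
    by apply: (BA (r, 0)); split => //=; exact: nbhs_singleton.
  have [M _ h] := within_continuous_bounded T0 ct.
  by exists M.
have [M MP] := fin_all_exists bound.
pose S0 := \sum_(c < d) M c ^+ 2.
have S00 : 0 <= S0 by rewrite sumr_ge0// => c _; exact: sqr_ge0.
exists (2 * S0 + 2 * L ^+ 2) => [|t x tT].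
  by rewrite addr_ge0// mulr_ge0// sqr_ge0.
have s0 : \sum_(c < d) s t 0 0 c ^+ 2 <= S0.
  apply: ler_sum => c _; have := MP c t tT.
  move=> h; rewrite -(real_normK (num_real (s t 0 0 c))).
  by rewrite lerXn2r ?nnegrE// (le_trans _ h).
have := lipschitz_sq (lip t x 0 tT); rewrite subr0.
set X := \sum_(c < d) x 0 c ^+ 2; set D := \sum_(c < d) _ => DX.
have X0 : 0 <= X by rewrite sumr_ge0// => c _; exact: sqr_ge0.
have : \sum_(c < d) s t x 0 c ^+ 2 <= 2 * D + 2 * \sum_(c < d) s t 0 0 c ^+ 2.
  rewrite !mulr_sumr -big_split/=; apply: ler_sum => c _; rewrite !mxE.
  by have := sqr_ge0 (s t x 0 c - 2 * s t 0 0 c); nra.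
have : 0 <= L ^+ 2 by exact: sqr_ge0.
by nra.
Qed.

End vector_functions.

Section measurability_of_lipschitz.
Context {disp : measure_display} {U : measurableType disp} {R : realType} {d : nat}.

(** Round the coordinates of Z down to multiples of 1/(n+1).  The rounded vector
    takes countably many values, so its image under h is measurable, and it
    tends to h (Z w) by the Lipschitz condition. *)
Lemma measurable_lipschitz_comp (Z : U -> 'rV[R]_d) (h : 'rV[R]_d -> R) (L : R) :
  (forall x y, (h x - h y) ^+ 2 <= L ^+ 2 * \sum_(c < d) (x - y) 0 c ^+ 2) ->
  (forall c, measurable_fun setT (fun w => Z w 0 c)) ->
  measurable_fun setT (fun w => h (Z w)).
Proof.
move=> lip mZ.
pose q n (k : {ffun 'I_d -> int}) : 'rV[R]_d :=
  \row_c ((k c)%:~R / n.+1%:R).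
pose k n w : {ffun 'I_d -> int} := [ffun c => Num.floor (Z w 0 c * n.+1%:R)].
apply: (@measurable_fun_cvg _ _ _ _ (fun n w => h (q n (k n w)))).
  move=> n _ B mB; rewrite setTI.
  rewrite (_ : _ @^-1` _ = \bigcup_(v : {ffun 'I_d -> int})
    (if asbool (B (h (q n v))) then \bigcap_(c in [set: 'I_d])
      ((fun w => Z w 0 c * n.+1%:R) @^-1` `[(v c)%:~R, (v c + 1)%:~R[)
     else set0)); last first.
    apply/seteqP; split => [w Bw|w [v _]].
      exists (k n w) => //; rewrite asboolT// => c _ /=.
      by rewrite in_itv/= ffunE floor_itv.
    case: asboolP => // Bv vw.
    rewrite /preimage/=; suff -> : k n w = v by [].
    apply/ffunP => c; rewrite ffunE; apply/eqP.
    by rewrite floor_eq; have := vw c I; rewrite /= in_itv.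
  apply: countable_bigcupT_measurable => [|v]; first exact: countableP.
  case: asboolP => // _; apply: fin_bigcap_measurable => // c _.
  rewrite -[X in measurable X]setTI.
  suff : measurable_fun setT (fun w => Z w 0 c * n.+1%:R) by apply.
  exact: measurable_funM.
move=> w _; apply/cvgrPdist_le => e e0.
have L1 : 0 < `|L| * (d%:R + 1) + 1.
  by rewrite ltr_wpDl// mulr_ge0// addr_ge0.
near=> n.
have n1 : n.+1%:R^-1 * (`|L| * (d%:R + 1) + 1) <= e.
  rewrite -ler_pdivlMr//; apply: ltW; near: n.
  exact: near_infty_natSinv_lt (PosNum (divr_gt0 e0 L1)).
have coord c : (Z w - q n (k n w)) 0 c ^+ 2 <= n.+1%:R^-1 ^+ 2.
  rewrite !mxE ffunE; have := floor_itv (Z w 0 c * n.+1%:R).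
  set m := Num.floor _ => /andP[m1]; rewrite intrD => m2.
  have N0 : 0 < n.+1%:R :> R by [].
  have lo : 0 <= Z w 0 c - m%:~R / n.+1%:R by rewrite subr_ge0 ler_pdivrMr.
  rewrite lerXn2r ?nnegrE// ?invr_ge0//.
  rewrite lerBlDr -[X in X + _]mul1r -mulrDl ler_pdivlMr// addrC.
  exact: ltW.
have sq : (h (Z w) - h (q n (k n w))) ^+ 2 <= (`|L| * (d%:R + 1) * n.+1%:R^-1) ^+ 2.
  rewrite (le_trans (lip _ _))// exprMn exprMn real_normK ?num_real//.
  rewrite -mulrA ler_wpM2l ?sqr_ge0//.
  apply: (@le_trans _ _ (\sum_(c < d) n.+1%:R^-1 ^+ 2)).
    by apply: ler_sum => c _.
  rewrite sumr_const card_ord -[leLHS]mulr_natl ler_wpM2r ?sqr_ge0//.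
  by have : 0 <= d%:R :> R by []; nra.
rewrite -(real_normK (num_real (h _ - _))) in sq.
have L0 : 0 <= `|L| * (d%:R + 1) * n.+1%:R^-1.
  by apply: mulr_ge0 => //; apply: mulr_ge0 => //; exact: addr_ge0.
move: sq; rewrite ler_pXn2r//.
move=> /le_trans; apply; apply: le_trans n1.
by rewrite mulrC ler_wpM2l// lerDl.
Unshelve. all: by end_near. Qed.

End measurability_of_lipschitz.

Section measurability_of_lipschitz_wrt.
Context {disp : measure_display} {Om : measurableType disp} {R : realType} {d : nat}.

Lemma measurable_wrt_lipschitz (G : set (set Om)) (Z : Om -> 'rV[R]_d)
    (s : 'rV[R]_d -> 'rV[R]_d) (L : R) c :
  (forall x y, enorm (s x - s y) <= L * enorm (x - y)) ->
  (forall c, measurable_wrt <<s G>> (fun w => Z w 0 c)) ->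
  measurable_wrt <<s G>> (fun w => s (Z w) 0 c).
Proof.
move=> lip GZ; apply/measurable_wrtE.
apply: (@measurable_lipschitz_comp _ (g_sigma_algebraType G) _ _ Z
  (fun x => s x 0 c) L) => [x y|i]; last exact/measurable_wrtE.
by have := lipschitz_coord_sq c (lip x y); rewrite !mxE.
Qed.

End measurability_of_lipschitz_wrt.

(** * One-step estimates and discrete Gronwall *)

Section time_grid.
Context {R : realType}.
Variables (T : R) (K : nat).
Hypotheses (T0 : 0 < T) (K0 : (0 < K)%N).
Notation h := (T / K%:R).

Lemma step_ge0 : 0 <= h. Proof. by rewrite divr_ge0// ltW. Qed.

Lemma step_le : h <= T.
Proof. by rewrite ler_pdivrMr ?ltr0n// ler_peMr ?ler1n// ltW. Qed.

Lemma gridS k : grid T K k.+1 = grid T K k + h.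
Proof. by rewrite /grid -natr1 mulrDl mul1r. Qed.

Lemma gridB k : grid T K k.+1 - grid T K k = h.
Proof. by rewrite gridS addrC addKr. Qed.

Lemma grid_ge0 k : 0 <= grid T K k.
Proof. by rewrite mulr_ge0 ?step_ge0. Qed.

Lemma grid_leS k : grid T K k <= grid T K k.+1.
Proof. by rewrite gridS lerDl step_ge0. Qed.

Lemma grid_le k : (k <= K)%N -> grid T K k <= T.
Proof.
move=> kK; rewrite /grid mulrCA ler_piMr ?(ltW T0)//.
by rewrite ler_pdivrMr ?ltr0n// mul1r ler_nat.
Qed.

End time_grid.

Section real_estimates.
Context {R : realType}.
Implicit Types (a p h T D u v : R).

(** A step with weights p = 1 + O(h) and a = O(h) increases squares by O(h)
    only, because the perturbation enters to first order through the cross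
    term 2 u ((p - 1) u + a v). *)
Lemma perturbed_square p a h T D u v : 0 <= h -> h <= T -> 0 <= D ->
  `|p - 1| <= D * h -> `|a| <= D * h ->
  (p * u + a * v) ^+ 2 <= u ^+ 2 + h * (3 * D + 2 * D ^+ 2 * T) * (u ^+ 2 + v ^+ 2).
Proof.
move=> h0 hT D0 pD aD; set e := p - 1 in pD.
have -> : p = 1 + e by rewrite /e; ring.
have Dh : 0 <= D * h by rewrite mulr_ge0.
have eD2 : e ^+ 2 <= (D * h) ^+ 2.
  by rewrite -(real_normK (num_real e)) lerXn2r ?nnegrE.
have aD2 : a ^+ 2 <= (D * h) ^+ 2.
  by rewrite -(real_normK (num_real a)) lerXn2r ?nnegrE.
have cross : 2 * u * (e * u + a * v) <= D * h * (3 * u ^+ 2 + v ^+ 2).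
  have e1 : e <= D * h by rewrite (le_trans (ler_norm _)).
  have u2 : 0 <= u ^+ 2 by exact: sqr_ge0.
  have h1 : 2 * (a * (u * v)) <= D * h * (u ^+ 2 + v ^+ 2).
    apply: (@le_trans _ _ (`|a| * (2 * `|u * v|))).
      by rewrite [leRHS]mulrCA ler_pM2l// -normrM ler_norm.
    have uv : 2 * `|u * v| <= u ^+ 2 + v ^+ 2.
      rewrite normrM -(real_normK (num_real u)) -(real_normK (num_real v)).
      by have := sqr_ge0 (`|u| - `|v|); nra.
    by rewrite ler_pM// mulr_ge0.
  have h2 : e * u ^+ 2 <= D * h * u ^+ 2 by rewrite ler_wpM2r.
  by nra.
have square : (e * u + a * v) ^+ 2 <= 2 * (D * h) ^+ 2 * (u ^+ 2 + v ^+ 2).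
  have := sqr_ge0 (e * u - a * v).
  have := ler_wpM2r (sqr_ge0 u) eD2; have := ler_wpM2r (sqr_ge0 v) aD2.
  by nra.
have h2T : (D * h) ^+ 2 * (u ^+ 2 + v ^+ 2) <=
    h * (D ^+ 2 * T) * (u ^+ 2 + v ^+ 2).
  rewrite ler_wpM2r ?addr_ge0 ?sqr_ge0// exprMn.
  have -> : h * (D ^+ 2 * T) = D ^+ 2 * (h * T) by ring.
  by rewrite ler_wpM2l ?sqr_ge0// expr2 ler_wpM2l.
have uv2 : 0 <= D * h * v ^+ 2 by rewrite mulr_ge0// sqr_ge0.
by nra.
Qed.

(** The recursion makes v k + 1 grow at most geometrically, and
    1 + h C <= exp (h C). *)
Lemma discrete_gronwall (v : nat -> R) (C h : R) n : 0 <= C -> 0 <= h ->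
  (forall k, 0 <= v k) ->
  (forall k, (k < n)%N -> v k.+1 <= (1 + h * C) * v k + h * C) ->
  forall k, (k <= n)%N -> v k + 1 <= expR (k%:R * (h * C)) * (v 0%N + 1).
Proof.
move=> C0 h0 v0 vS; elim=> [_|k ih kn]; first by rewrite mul0r expR0 mul1r.
have hC : 0 <= h * C by exact: mulr_ge0.
apply: (@le_trans _ _ ((1 + h * C) * (v k + 1))).
  by have := vS k kn; lra.
rewrite (_ : k.+1%:R * (h * C) = h * C + k%:R * (h * C)); last first.
  by rewrite -[k.+1%:R]natr1; ring.
rewrite expRD -mulrA.
by rewrite ler_pM ?addr_ge0 ?expR_ge1Dx ?ih// ltnW.
Qed.

End real_estimates.

(** * Moments of the exponential integrator *)

Section scheme.
Context {disp : measure_display} {Om : measurableType disp} {R : realType}.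
Variables (P : probability Om R) (d : nat) (T : R) (f g : R -> R).
Variables (s_th : R -> 'rV[R]_d -> 'rV[R]_d) (L C S : R).
Variables (W : R -> Om -> 'rV[R]_d) (y0 : Om -> 'rV[R]_d).
Variable b : nat -> nat -> Om -> 'rV[R]_d.
Notation F := (filtration y0 W).
Notation mu := (@lebesgue_measure R).
Notation y K := (exp_integrator f g s_th T K y0 (b K)).

Hypotheses (T0 : 0 < T) (C0 : 0 <= C) (S0 : 0 <= S).
Hypothesis weights : forall s t, 0 <= s -> s <= t -> t <= T ->
  [/\ `|Phi f T t s - 1| <= C * (t - s),
      `|Phi f T t s - 1 - (t - s) * f (T - s)| <= C * (t - s) ^+ 2,
      `|\int[mu]_(r in `[s, t]) (Phi f T t r * g (T - r) ^+ 2)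
        - (t - s) * g (T - s) ^+ 2| <= C * (t - s) ^+ 2,
      `|g (T - s)| <= C &
      forall r, r \in `[s, t] ->
        `|Phi f T t r * g (T - r) - g (T - s)| <= C * (t - s)].
Hypothesis s_lip : forall t x y, t \in `[0, T] ->
  enorm (s_th t x - s_th t y) <= L * enorm (x - y).
Hypothesis s_growth : forall t x, t \in `[0, T] ->
  \sum_(c < d) s_th t x 0 c ^+ 2 <= S * (1 + \sum_(c < d) x 0 c ^+ 2).
Hypotheses (W_wiener : is_wiener P W) (y0_random : random_vector y0)
  (y0_indep : indep_sigma P <<s coord_events y0 >>
     <<s \bigcup_(t in `[0, +oo[) coord_events (W t) >>)
  (y0_sqint : forall c, square_integrable P (fun w => y0 w 0 c)).
Hypothesis b_ito : forall K k c, (k < K)%N ->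
  is_ito P F (fun t w => W t w 0 c)
    (fun s _ => Phi f T (grid T K k.+1) s * g (T - s))
    (grid T K k) (grid T K k.+1) (fun w => b K k w 0 c).

Let score K k w := s_th (T - grid T K k) (y K k w).

Let score_time K k : (k < K)%N -> T - grid T K k \in `[0, T].
Proof.
move=> kK; have K0 : (0 < K)%N by exact: leq_ltn_trans kK.
by rewrite in_itv/= subr_ge0 grid_le ?(ltnW kK)//= lerBlDr lerDl grid_ge0.
Qed.

Lemma exp_integrator_coordS K k c : (fun w => y K k.+1 w 0 c) =
  (fun w => Phi f T (grid T K k.+1) (grid T K k) * y K k w 0 c +
            a_coef f g T K k * score K k w 0 c + b K k w 0 c).
Proof. by apply/funext => w; rewrite /= !mxE. Qed.

Lemma exp_integrator_adapted K k c : (k <= K)%N ->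
  measurable_wrt (F (grid T K k)) (fun w => y K k w 0 c).
Proof.
elim: k c => [|k ih] c kK; first exact: initial_adapted.
have K0 : (0 < K)%N by exact: leq_ltn_trans kK.
have FS : F (grid T K k) `<=` F (grid T K k.+1).
  by apply: filtration_sub; exact: grid_leS.
rewrite exp_integrator_coordS; apply: measurable_wrtD.
  apply: measurable_wrtD; apply: measurable_wrtZ; apply: (measurable_wrtS FS).
    exact: ih (ltnW kK).
  apply: measurable_wrt_lipschitz => [x z|i]; last exact: ih (ltnW kK).
  exact: s_lip (score_time kK).
by have [_ _ + _] := b_ito c kK.
Qed.

Lemma score_adapted K k c : (k < K)%N ->
  measurable_wrt (F (grid T K k)) (fun w => score K k w 0 c).
Proof.
move=> kK; apply: measurable_wrt_lipschitz => [x z|i].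
  exact: s_lip (score_time kK).
exact: exp_integrator_adapted (ltnW kK).
Qed.

Section one_step.
Variables (K k : nat).
Hypothesis kK : (k < K)%N.
Let K0 : (0 < K)%N. Proof. exact: leq_ltn_trans kK. Qed.
Notation h := (T / K%:R).
Notation tk := (grid T K k).
Notation tk1 := (grid T K k.+1).
Let h0 : 0 <= h. Proof. exact: step_ge0. Qed.
Let hT : h <= T. Proof. exact: step_le. Qed.
Let tk0 : 0 <= tk. Proof. exact: grid_ge0. Qed.
Let tkS : tk <= tk1. Proof. exact: grid_leS. Qed.
Let tk1T : tk1 <= T. Proof. exact: grid_le. Qed.

(** The integrand of b_k is frozen at g(T - t_k), from which it differs by at
    most C h on the step. *)
Lemma noise_increment c :
  let D w := b K k w 0 c - g (T - tk) * (W tk1 w 0 c - W tk w 0 c) in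
  \int[P]_w (D w ^+ 2) <= 32 * C ^+ 2 * h ^+ 3 /\
  forall Y, measurable_wrt (F tk) Y -> square_integrable P Y ->
    \int[P]_w (Y w * D w) = 0.
Proof.
have [_ _ _ _ wt] := weights tk0 tkS tk1T.
have [_ D2 orth] := is_ito_deterministic W_wiener y0_random y0_indep tk0 tkS
  wt (b_ito c kK).
split => //; rewrite (le_trans D2)// gridB.
by rewrite (_ : 32 * (C * h) ^+ 2 * h = 32 * C ^+ 2 * h ^+ 3)//; ring.
Qed.

(** The case q = 0: E b_k^2 = O(h), and b_k is orthogonal to every
    square-integrable variable known at time t_k. *)
Lemma noise_moments c : [/\ square_integrable P (fun w => b K k w 0 c),
  \int[P]_w (b K k w 0 c ^+ 2) <= 32 * (C * (1 + T)) ^+ 2 * h &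
  forall Y, measurable_wrt (F tk) Y -> square_integrable P Y ->
    \int[P]_w (Y w * b K k w 0 c) = 0].
Proof.
have [_ _ _ gC wt] := weights tk0 tkS tk1T.
have wt0 r : r \in `[tk, tk1] ->
    `|Phi f T tk1 r * g (T - r) - 0| <= C * (1 + T).
  move=> /wt; rewrite gridB subr0 => h1.
  rewrite -[X in `|X|](subrK (g (T - tk))) (le_trans (ler_normD _ _))//.
  have : C * h <= C * T by rewrite ler_wpM2l.
  by lra.
have [sb b2 orth] := is_ito_deterministic W_wiener y0_random y0_indep tk0 tkS
  wt0 (b_ito c kK).
have E : (fun w => b K k w 0 c - 0 * (W tk1 w 0 c - W tk w 0 c)) =
    (fun w => b K k w 0 c).
  by apply/funext => w; rewrite mul0r subr0.
split => //.
  by move: b2; rewrite gridB; under eq_Rintegral do rewrite mul0r subr0.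
move=> Y FY sY; have := orth Y FY sY.
by under eq_Rintegral do rewrite mul0r subr0.
Qed.

Lemma drift_weight_le : `|a_coef f g T K k| <= (C * T + C ^+ 2) * h.
Proof.
have [_ _ + gC _] := weights tk0 tkS tk1T.
rewrite gridB -/(a_coef f g T K k) => aC.
rewrite -[X in `|X|](subrK (h * g (T - tk) ^+ 2)) (le_trans (ler_normD _ _))//.
rewrite mulrDl lerD//.
  rewrite (le_trans aC)// (_ : C * h ^+ 2 = C * h * h); last by ring.
  by rewrite ler_wpM2r// ler_wpM2l.
rewrite normrM [`|h|]ger0_norm// mulrC ler_wpM2r//.
by rewrite normrX lerXn2r ?nnegrE.
Qed.

Hypothesis y_sqint : forall c, square_integrable P (fun w => y K k w 0 c).

Let ysq w := \sum_(c < d) y K k w 0 c ^+ 2.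

Let ysq_integrable : P.-integrable setT (EFin \o ysq).
Proof. by apply: integrable_sum_fin => c; case: (y_sqint c). Qed.

Let expectation_ysq : \int[P]_w ysq w = \sum_(c < d) \int[P]_w (y K k w 0 c ^+ 2).
Proof. by apply: Rintegral_sum => c; case: (y_sqint c). Qed.

Let scoresq_le w : \sum_(c < d) score K k w 0 c ^+ 2 <= S * (1 + ysq w).
Proof. exact: s_growth (score_time kK). Qed.

Lemma score_sqint c : square_integrable P (fun w => score K k w 0 c).
Proof.
have ms : measurable_fun setT (fun w => score K k w 0 c).
  apply: measurable_wrt_fun (score_adapted c kK).
  exact: filtration_measurable W_wiener y0_random _.
split => //; apply: (@dominated_integrable _ _ _ _ _ (fun w => S * (1 + ysq w))).
- exact: measurable_funX.
- move=> w; rewrite ger0_norm ?sqr_ge0//; apply: le_trans (scoresq_le w).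
  by rewrite (bigD1 c)//= lerDl sumr_ge0// => i _; exact: sqr_ge0.
- apply: integrableZ_fin; apply: integrableD_fin => //.
  exact: integrable_cst_fin.
Qed.

(** A common bound, up to the factor h, for Phi_k - 1 and a_k. *)
Definition weight_constant := C + C * T + C ^+ 2.
(** The first summand comes from the drift part of a step, the second from the
    d coordinates of its noise. *)
Definition growth_constant :=
  (3 * weight_constant + 2 * weight_constant ^+ 2 * T) * (1 + S)
  + d%:R * (32 * (C * (1 + T)) ^+ 2).

(** The drift part A is known at time t_k, hence orthogonal to the noise: second
    moments add up, and neither contributes more than O(h). *)
Lemma second_moment_step : (forall c, square_integrable P (fun w => y K k.+1 w 0 c)) /\
  \sum_(c < d) \int[P]_w (y K k.+1 w 0 c ^+ 2) <=
  (1 + h * growth_constant) * \sum_(c < d) \int[P]_w (y K k w 0 c ^+ 2)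
  + h * growth_constant.
Proof.
pose A c w := Phi f T tk1 tk * y K k w 0 c + a_coef f g T K k * score K k w 0 c.
have sA c : square_integrable P (A c).
  by apply: sqintD; apply: sqintZ => //; exact: score_sqint.
have FA c : measurable_wrt (F tk) (A c).
  apply: measurable_wrtD; apply: measurable_wrtZ; last exact: score_adapted.
  exact: exp_integrator_adapted (ltnW kK).
have yS c w : y K k.+1 w 0 c = A c w + b K k w 0 c by rewrite /= !mxE.
have coord c : \int[P]_w (y K k.+1 w 0 c ^+ 2) <=
    \int[P]_w (A c w ^+ 2) + 32 * (C * (1 + T)) ^+ 2 * h.
  have [sb b2 orth] := noise_moments c.
  have -> : \int[P]_w (y K k.+1 w 0 c ^+ 2) = \int[P]_w ((A c w + b K k w 0 c) ^+ 2).
    by apply: eq_Rintegral => w _; rewrite yS.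
  by rewrite expectation_sqrD// orth// mulr0 addr0 lerD2l.
split.
  move=> c; under eq_fun do rewrite yS.
  by have [sb _ _] := noise_moments c; exact: sqintD.
set D := weight_constant; set E1 := 3 * D + 2 * D ^+ 2 * T.
have CT : 0 <= C * T by rewrite mulr_ge0// ltW.
have C2 : 0 <= C ^+ 2 by exact: sqr_ge0.
have D0 : 0 <= D by rewrite /D /weight_constant; have := C0; lra.
have E10 : 0 <= E1.
  by rewrite addr_ge0 ?mulr_ge0 ?sqr_ge0// ltW.
have [PhiC _ _ _ _] := weights tk0 tkS tk1T.
have PhiD : `|Phi f T tk1 tk - 1| <= D * h.
  rewrite (le_trans PhiC)// gridB ler_wpM2r// /D /weight_constant.
  by have := C0; lra.
have aD : `|a_coef f g T K k| <= D * h.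
  rewrite (le_trans drift_weight_le)// ler_wpM2r// /D /weight_constant.
  by have := C0; lra.
have ysq0 w : 0 <= ysq w by rewrite sumr_ge0// => c _; exact: sqr_ge0.
have Asq w : \sum_(c < d) A c w ^+ 2 <=
    (1 + h * (E1 * (1 + S))) * ysq w + h * (E1 * (1 + S)).
  apply: (@le_trans _ _
    (\sum_(c < d) (y K k w 0 c ^+ 2 +
      h * E1 * (y K k w 0 c ^+ 2 + score K k w 0 c ^+ 2)))).
    by apply: ler_sum => c _; exact: perturbed_square.
  rewrite big_split/= -mulr_sumr big_split/= -/(ysq w).
  have hE : 0 <= h * E1 by exact: mulr_ge0.
  have := ler_wpM2l hE (scoresq_le w).
  by have := ysq0 w; nra.
have sumA : \sum_(c < d) \int[P]_w (A c w ^+ 2) <=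
    (1 + h * (E1 * (1 + S))) * \sum_(c < d) \int[P]_w (y K k w 0 c ^+ 2)
    + h * (E1 * (1 + S)).
  rewrite -expectation_ysq -[X in _ <= _ + X](@expectation_cst _ _ _ P).
  have iA c : P.-integrable setT (EFin \o (fun w => A c w ^+ 2)) by case: (sA c).
  rewrite -(Rintegral_sum _ iA) -RintegralZl// -RintegralD//; last 2 first.
  - exact: integrableZ_fin.
  - exact: integrable_cst_fin.
  apply: expectation_le => //; first exact: integrable_sum_fin.
  by apply: integrableD_fin; [exact: integrableZ_fin|exact: integrable_cst_fin].
apply: (@le_trans _ _ (\sum_(c < d) (\int[P]_w (A c w ^+ 2)
    + 32 * (C * (1 + T)) ^+ 2 * h))).
  by apply: ler_sum => c _; exact: coord.
rewrite big_split/= sumr_const card_ord -[_ *+ d]mulr_natl.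
set B := 32 * (C * (1 + T)) ^+ 2.
have B0 : 0 <= B by rewrite mulr_ge0// sqr_ge0.
have dB : 0 <= d%:R * B by rewrite mulr_ge0.
rewrite /growth_constant -/D -/E1 -/B.
set Y := \sum_(c < d) \int[P]_w (y K k w 0 c ^+ 2) in sumA *.
have Y0 : 0 <= Y by rewrite sumr_ge0// => c _; exact: expectation_sqr_ge0.
have hdBY : 0 <= h * (d%:R * B) * Y by apply: mulr_ge0 => //; exact: mulr_ge0.
by lra.
Qed.

Lemma drift_remainder_bound (V : R) :
  \sum_(c < d) \int[P]_w (y K k w 0 c ^+ 2) <= V ->
  let r c w := (Phi f T tk1 tk - 1 - h * f (T - tk)) * y K k w 0 c +
    (a_coef f g T K k - h * g (T - tk) ^+ 2) * score K k w 0 c in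
  (forall c, square_integrable P (r c)) /\
  \sum_(c < d) \int[P]_w (r c w ^+ 2) <=
    2 * C ^+ 2 * (V + S * (1 + V)) * h ^+ 4.
Proof.
move=> yV r.
have [_ Phi2 + _ _] := weights tk0 tkS tk1T.
rewrite gridB -/(a_coef f g T K k) in Phi2 *; move=> a2.
have sr c : square_integrable P (r c).
  by apply: sqintD; apply: sqintZ => //; exact: score_sqint.
split => //.
have Ch : 0 <= C * h ^+ 2 by rewrite mulr_ge0// sqr_ge0.
set p := Phi f T tk1 tk - 1 - h * f (T - tk) in Phi2 r sr *.
set q := a_coef f g T K k - h * g (T - tk) ^+ 2 in a2 r sr *.
have p2 : p ^+ 2 <= (C * h ^+ 2) ^+ 2.
  by rewrite -(real_normK (num_real p)) lerXn2r ?nnegrE.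
have q2 : q ^+ 2 <= (C * h ^+ 2) ^+ 2.
  by rewrite -(real_normK (num_real q)) lerXn2r ?nnegrE.
pose c4 := 2 * (C * h ^+ 2) ^+ 2.
have c40 : 0 <= c4 by rewrite mulr_ge0// sqr_ge0.
have rsq w : \sum_(c < d) r c w ^+ 2 <= c4 * (1 + S) * ysq w + c4 * S.
  apply: (@le_trans _ _
    (\sum_(c < d) c4 * (y K k w 0 c ^+ 2 + score K k w 0 c ^+ 2))).
    apply: ler_sum => c _; rewrite /r.
    set u := y K k w 0 c; set v := score K k w 0 c.
    have := ler_wpM2r (sqr_ge0 u) p2; have := ler_wpM2r (sqr_ge0 v) q2.
    by have := sqr_ge0 (p * u - q * v); rewrite /c4; nra.
  rewrite -mulr_sumr big_split/= -/(ysq w).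
  by have := ler_wpM2l c40 (scoresq_le w); lra.
have ir c : P.-integrable setT (EFin \o (fun w => r c w ^+ 2)) by case: (sr c).
rewrite -(Rintegral_sum _ ir).
apply: (@le_trans _ _ (\int[P]_w (c4 * (1 + S) * ysq w + c4 * S))).
  apply: expectation_le => //; first exact: integrable_sum_fin.
  by apply: integrableD_fin; [exact: integrableZ_fin|exact: integrable_cst_fin].
rewrite RintegralD//; last 2 first.
- exact: integrableZ_fin.
- exact: integrable_cst_fin.
rewrite RintegralZl// expectation_cst expectation_ysq.
have cS : 0 <= c4 * (1 + S) by rewrite mulr_ge0// addr_ge0.
have := ler_wpM2l cS yV.
rewrite (_ : 2 * C ^+ 2 * (V + S * (1 + V)) * h ^+ 4 = c4 * (V + S * (1 + V)));
  last by rewrite /c4; ring.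
by lra.
Qed.

End one_step.

(** The constant of the recursion does not depend on the step, and k h <= T, so
    Gronwall bounds all iterates of all grids at once. *)
Lemma second_moment_bound : exists2 V, 0 <= V & forall K k, (k <= K)%N ->
  (forall c, square_integrable P (fun w => y K k w 0 c)) /\
  \sum_(c < d) \int[P]_w (y K k w 0 c ^+ 2) <= V.
Proof.
set G := growth_constant.
pose v0 := \sum_(c < d) \int[P]_w (y0 w 0 c ^+ 2).
have v00 : 0 <= v0 by rewrite sumr_ge0// => c _; exact: expectation_sqr_ge0.
have CT : 0 <= C * T by rewrite mulr_ge0// ltW.
have G0 : 0 <= G.
  have D0 : 0 <= weight_constant.
    by rewrite /weight_constant; have := C0; have := sqr_ge0 C; lra.
  apply: addr_ge0; last first.
    by apply: mulr_ge0 => //; apply: mulr_ge0 => //; exact: sqr_ge0.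
  apply: mulr_ge0; last exact: addr_ge0.
  apply: addr_ge0; first exact: mulr_ge0.
  apply: mulr_ge0; last exact: ltW.
  by apply: mulr_ge0 => //; exact: sqr_ge0.
exists (expR (T * G) * (v0 + 1)) => [|K k kK].
  by rewrite mulr_ge0 ?expR_ge0 ?addr_ge0.
have [K00|K0] := posnP K; last first.
  have sy j : (j <= K)%N -> forall c, square_integrable P (fun w => y K j w 0 c).
    elim: j => [_|j ih jK]; first exact: y0_sqint.
    by have [+ _] := second_moment_step jK (ih (ltnW jK)).
  split; first exact: sy.
  have := @discrete_gronwall _
    (fun j => \sum_(c < d) \int[P]_w (y K j w 0 c ^+ 2)) G (T / K%:R) K G0
    (step_ge0 K T0).
  move=> /(_ _ _ k kK) vk; apply: (@le_trans _ _
    (\sum_(c < d) \int[P]_w (y K k w 0 c ^+ 2) + 1)); first by rewrite lerDl.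
  apply: le_trans (vk _ _) _.
  - by move=> j; rewrite sumr_ge0// => c _; exact: expectation_sqr_ge0.
  - by move=> j jK; have [_ +] := second_moment_step jK (sy _ (ltnW jK)).
  rewrite -/v0 ler_wpM2r ?addr_ge0// ler_expR mulrA ler_wpM2r//.
  exact: grid_le.
move: kK; rewrite K00 leqn0 => /eqP ->; split; first exact: y0_sqint.
rewrite -/v0; apply: (@le_trans _ _ (v0 + 1)); first by rewrite lerDl.
by rewrite ler_peMl ?addr_ge0// -[leLHS]expR0 ler_expR mulr_ge0// ltW.
Qed.

End scheme.

(** * Coefficient functions and multiple integrals of order one *)

Section multiple_integrals.
Context {disp : measure_display} {Om : measurableType disp} {R : realType}.
Variables (P : probability Om R) (d : nat).
Variables (W : R -> Om -> 'rV[R]_d) (y0 : Om -> 'rV[R]_d).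
Hypothesis W_wiener : is_wiener P W.
Notation F := (filtration y0 W).
Notation mu := (@lebesgue_measure R).

(** The constant is itself a simple process with a single interval ]s, t]; the
    two differ at the time s only. *)
Lemma is_ito_cst (c : 'I_d) (q s t : R) : 0 <= s -> s <= t ->
  is_ito P F (fun t w => W t w 0 c) (fun _ _ => q) s t
    (fun w => q * (W t w 0 c - W s w 0 c)).
Proof.
move=> s0 st; split.
- exact: measurable_cst.
- by move=> r _; exact: measurable_wrt_cst.
- apply: measurable_wrtZ; apply: measurable_wrtB; apply: wiener_adapted => //.
  exact: le_trans st.
exists (fun _ => 1%N), (fun _ i => if i is 0 then s else t), (fun _ _ _ => q).
split.
- move=> _; split => //; first by case.
  by move=> i _; split; [exact: measurable_wrt_cst|exists `|q|].
- apply: cvg_near_cst; apply: nearW => _; apply: integral0_eq => w _.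
  transitivity (\int[mu]_(r in `[s, t]) ((q ^+ 2)%:E * (\1_[set s] r)%:E))%E.
    apply: eq_integral => r; rewrite inE /= in_itv/= => /andP[sr rt].
    rewrite /simple_process big_ord_recl big_ord0 addr0 /=.
    rewrite -EFinM; congr EFin; rewrite !indicE.
    have [->|rs] := eqVneq r s.
      have -> : (s \in [set s]) = true by exact/mem_set.
      have -> : (s \in `]s, t]%classic) = false.
        by apply/memNset; rewrite /= in_itv/= ltxx.
      by rewrite mulr0 subr0 mulr1.
    have -> : (r \in [set s]) = false by apply/memNset => /= /eqP; apply/negP.
    have -> : (r \in `]s, t]%classic) = true.
      by apply/mem_set; rewrite /= in_itv/= rt lt_neqAle eq_sym rs sr.
    by rewrite mulr1 subrr expr0n mulr0.
  rewrite ge0_integralZl//; last by rewrite lee_fin sqr_ge0.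
    rewrite integral_indic//= setIidl; last first.
      by move=> _ ->; rewrite /= in_itv/= lexx.
    by rewrite [X in (_ * X)%E]lebesgue_measure_set1 mule0.
  exact/measurable_EFinP/measurable_indic.
- apply: cvg_near_cst; apply: nearW => _; apply: integral0_eq => w _.
  by rewrite /simple_integral big_ord_recl big_ord0 addr0 subrr expr0n.
Qed.

Lemma wiener_integral_cst (c : 'I_d) (q s t : R) : 0 <= s -> s <= t ->
  multiple_integral P F W (fun _ _ => q) s t [:: lift ord0 c]
    (fun r w => q * (W r w 0 c - W s w 0 c)).
Proof.
move=> s0 st; rewrite -[[:: _]]/(rcons [::] (lift ord0 c)).
apply: MI_wiener; first exact: MI_nil.
- by move=> r; rewrite in_itv/= => /andP[sr _]; exact: is_ito_cst.
case: W_wiener => _ _ _ _; apply: filterS => w /(_ c) Wc.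
have sub : `[s, t] `<=` `[0, +oo[%classic.
  by move=> r; rewrite /= !in_itv/= andbT => /andP[sr _]; exact: le_trans sr.
have {}Wc := continuous_subspaceW sub Wc.
move=> r; apply: cvgM; first exact: cvg_cst.
by apply: cvgB; [exact: Wc|exact: cvg_cst].
Qed.

Lemma wiener_double_integral0 (c1 c2 : 'I_d) (s t : R) : 0 <= s -> s <= t ->
  multiple_integral P F W (fun _ _ => 0) s t [:: lift ord0 c1; lift ord0 c2]
    (fun _ _ => 0).
Proof.
move=> s0 st.
have E c r : (fun w => 0 * (W r w 0 c - W s w 0 c)) = (fun=> 0).
  by apply/funext => w; rewrite mul0r.
rewrite -[[:: _; _]]/(rcons [:: lift ord0 c1] (lift ord0 c2)).
apply: (@MI_wiener _ _ _ _ _ _ _ _ _ _ _ _ (fun _ _ => 0)).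
- have := wiener_integral_cst c1 0 s0 st.
  by congr multiple_integral; apply/funext => r; exact: E.
- move=> r; rewrite in_itv/= => /andP[sr _].
  by have := is_ito_cst c2 0 s0 sr; rewrite E.
- by apply: aeW => w r; exact: cvg_cst.
Qed.

Lemma time_integral_cst (X : Om -> R) (s t : R) : s <= t ->
  multiple_integral P F W (fun _ w => X w) s t [:: ord0]
    (fun r w => (r - s) * X w).
Proof.
move=> st; rewrite -[[:: _]]/(rcons [::] (ord0 : 'I_d.+1)).
apply: MI_time; first exact: MI_nil.
apply: aeW => w; split.
  exact: (@continuous_itv_integrable _ (fun=> X w) s t (fun r => cvg_cst _)).
move=> r; rewrite in_itv/= => /andP[sr rt].
by rewrite Rintegral_itv_cst.
Qed.

End multiple_integrals.

Section index_set.
Context {R : realType} {d : nat}.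
Implicit Types al : multi_index d.
Notation A1 := (A_set (1 : R) `\ ([::] : multi_index d)).

(** The alternative l(al) = n(al) = 3/2 in the definition of the index set has no
    solution for parity reasons. *)
Lemma order1_indices al : A1 al -> (exists j, al = [:: j]) \/
  exists c1 c2, al = [:: lift ord0 c1; lift ord0 c2].
Proof.
case=> -[sz|[_ sal]] /= nonempty; last first.
  have : ((2 * size al)%N%:R = 3%N%:R :> R).
    by rewrite natrM sal; field.
  move=> /eqP; rewrite eqr_nat => /eqP /(congr1 odd).
  by rewrite oddM.
move: sz nonempty; rewrite mulr1 ler_nat /nzero.
case: al => [|j [|j' [|j'' al]]] //= sz _; first by left; exists j.
right; have : (j != ord0) && (j' != ord0) by move: sz; case: eqP; case: eqP.
move=> /andP[j0 j'0].
case: (unliftP ord0 j) j0 => [c1 ->|->] // _.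
case: (unliftP ord0 j') j'0 => [c2 ->|->] // _.
by exists c1, c2.
Qed.

Lemma order1_singleton (j : 'I_d.+1) : A1 [:: j].
Proof.
split => //; left; rewrite mulr1 ler_nat /nzero /=.
by case: eqP.
Qed.

Lemma sum_order1 (V : nmodType) (f : multi_index d -> V) :
  (forall c1 c2, f [:: lift ord0 c1; lift ord0 c2] = 0) ->
  \sum_(al \in A1) f al = f [:: ord0] + \sum_(c < d) f [:: lift ord0 c].
Proof.
move=> f0.
pose r := [seq [:: j] | j <- enum 'I_d.+1] : seq (multi_index d).
rewrite -(@fsbig_widen _ _ _ _ [set` r]); last 2 first.
- by move=> _ /= /mapP[j _ ->]; exact: order1_singleton.
- move=> al [Aal alr]; case: (order1_indices Aal) => [[j alj]|[c1 [c2 ->]]].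
    by exfalso; apply: alr; rewrite /= alj map_f// mem_enum.
  exact: f0.
rewrite -fsbig_seq; last first.
  by rewrite map_inj_uniq ?enum_uniq// => i j [].
by rewrite big_map big_enum big_ord_recl.
Qed.

End index_set.

Section coefficient_functions.
Context {R : realType} {d : nat}.
Variables (T : R) (mu : R -> 'rV[R]_d -> 'rV[R]_d) (sg : R -> R).

Lemma derive_coord (i c : 'I_d) (x : 'rV[R]_d) :
  'D_(delta_mx 0 i) (fun x : 'rV[R]_d => x 0 c) x = (c == i)%:R.
Proof.
apply/cvg_lim => //; apply: cvg_near_cst; near=> h.
have h0 : h != 0 by near: h; exact: nbhs_dnbhs_neq.
rewrite /= !mxE addrK eqxx/= [LHS]mulrA mulVf// mul1r.
Unshelve. all: by end_near. Qed.

(** The punctured neighbourhoods of t must meet [0, T] for the limit to be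
    determined; to the right of t < T they do. *)
Lemma derive_on_cst (a t : R) : 0 <= t -> t < T ->
  derive_on `[0, T] (fun=> a) t = 0.
Proof.
move=> t0 tT; rewrite /derive_on /diff_quotient.
have pf : ProperFilter (within `[0, T] t^').
  split; last exact: within_filter.
  rewrite /within/= => H.
  have /filter_ex[] // : \forall s \near t^'+, False.
  have out : \forall s \near t^'+, ~ `[0, T]%classic s.
    apply: (@filterS _ (nbhs t) _ _ _ _ (H : nbhs t _)) => s sT ts.
    by apply: sT; rewrite gt_eqF.
  near=> s; suff : `[0, T]%classic s by near: s.
  rewrite /= in_itv/= (le_trans t0)/=; last first.
    by apply: ltW; near: s; exact: nbhs_right_gt.
  by apply: ltW; near: s; exact: nbhs_right_lt.
apply/cvg_lim => //.
by apply: cvg_near_cst; apply: nearW => s; rewrite subrr mulr0.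
Unshelve. all: by end_near. Qed.

Lemma coef_time (t : R) x : 0 <= t -> t < T ->
  coef T mu sg [:: ord0] t x = mu t x.
Proof.
move=> t0 tT; apply/rowP => c; rewrite !mxE /L_op unlift_none/=.
rewrite derive_on_cst// add0r [X in _ + _ * X]big1 ?mulr0 ?addr0.
  rewrite (bigD1 c)//= derive_coord eqxx mulr1 big1 ?addr0// => i ic.
  by rewrite derive_coord eq_sym (negbTE ic) mulr0.
move=> i _; have -> : 'D_(delta_mx 0 i) (fun x : 'rV[R]_d => x 0 c) =
    (fun=> (c == i)%:R : R).
  by apply/funext => z; exact: derive_coord.
exact: derive_cst.
Qed.

Lemma coef_wiener (t : R) x (c : 'I_d) :
  coef T mu sg [:: lift ord0 c] t x = sg t *: delta_mx 0 c.
Proof.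
by apply/rowP => i; rewrite !mxE /L_op liftK derive_coord eqxx.
Qed.

Lemma coef_double_wiener (t : R) x (c1 c2 : 'I_d) :
  coef T mu sg [:: lift ord0 c1; lift ord0 c2] t x = 0.
Proof.
apply/rowP => i; rewrite [LHS]mxE [RHS]mxE /L_op liftK.
transitivity (sg t * 'D_(delta_mx 0 c1)
  (fun x : 'rV[R]_d => coef T mu sg [:: lift ord0 c2] t x 0 i) x) => //.
have -> : (fun x : 'rV[R]_d => coef T mu sg [:: lift ord0 c2] t x 0 i) =
    (fun=> (sg t *: delta_mx 0 c2 : 'rV[R]_d) 0 i).
  by apply/funext => z; rewrite coef_wiener.
by rewrite derive_cst mulr0.
Qed.

End coefficient_functions.

(** * The exponential integrator as a strong scheme *)

Section frozen_coefficients.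
Context {disp : measure_display} {Om : measurableType disp} {R : realType}.
Variables (P : probability Om R) (d : nat) (T : R).
Variables (mu : R -> 'rV[R]_d -> 'rV[R]_d) (sg : R -> R).
Variables (W : R -> Om -> 'rV[R]_d) (y0 : Om -> 'rV[R]_d).
Hypothesis W_wiener : is_wiener P W.
Notation F := (filtration y0 W).
Notation A1 := (A_set (1 : R) `\ ([::] : multi_index d)).
Variables (Y : Om -> 'rV[R]_d) (s : R).
Hypotheses (s0 : 0 <= s) (sT : s < T).

(** The iterated integral, from s to r, of the coefficient function of al frozen
    at (s, Y); it vanishes for indices of length 2 as the noise is additive. *)
Definition frozen_integral (al : multi_index d) (r : R) (w : Om) : 'rV[R]_d :=
  if al is [:: j] then
    if unlift ord0 j is Some c
    then (sg s * (W r w 0 c - W s w 0 c)) *: delta_mx 0 c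
    else (r - s) *: mu s (Y w)
  else 0.

Lemma frozen_integralP (t : R) al c : s <= t -> A1 al ->
  multiple_integral P F W (fun _ w => coef T mu sg al s (Y w) 0 c) s t al
    (fun r w => frozen_integral al r w 0 c).
Proof.
move=> st /order1_indices[[j ->]|[c1 [c2 ->]]]; last first.
  have := wiener_double_integral0 y0 W_wiener c1 c2 s0 st.
  congr multiple_integral; last by apply/funext => r; apply/funext => w; rewrite mxE.
  by apply/funext => r; apply/funext => w; rewrite coef_double_wiener mxE.
have [c' ->|->] := unliftP ord0 j.
  have := wiener_integral_cst y0 W_wiener c' (sg s * (c == c')%:R) s0 st.
  congr multiple_integral; apply/funext => r; apply/funext => w.
    by rewrite coef_wiener !mxE eqxx.
  by rewrite /frozen_integral liftK !mxE eqxx/= mulrAC.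
have := time_integral_cst P W y0 (fun w => mu s (Y w) 0 c) st.
congr multiple_integral; apply/funext => r; apply/funext => w.
  by rewrite coef_time.
by rewrite /frozen_integral unlift_none mxE.
Qed.

Lemma frozen_coef_adapted al c : A1 al ->
  measurable_wrt (F s) (fun w => mu s (Y w) 0 c) ->
  measurable_wrt (F s) (fun w => coef T mu sg al s (Y w) 0 c).
Proof.
move=> Aal Fmu; case: (order1_indices Aal) => [[j ->]|[c1 [c2 ->]]]; last first.
  under eq_fun do rewrite coef_double_wiener mxE.
  exact: measurable_wrt_cst.
have [c' ->|->] := unliftP ord0 j.
  under eq_fun do rewrite coef_wiener.
  exact: measurable_wrt_cst.
by under eq_fun do rewrite coef_time//.
Qed.

(** The frozen scheme of order 1 is the Euler scheme. *)
Lemma sum_frozen_integral (t : R) w :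
  \sum_(al \in A1) frozen_integral al t w =
  (t - s) *: mu s (Y w) + sg s *: (W t w - W s w).
Proof.
rewrite sum_order1//= unlift_none; congr (_ + _).
rewrite [W t w - W s w]row_sum_delta scaler_sumr; apply: eq_bigr => c _.
by rewrite liftK !mxE scalerA.
Qed.

End frozen_coefficients.

Section remainder.
Context {disp : measure_display} {Om : measurableType disp} {R : realType}.
Variables (P : probability Om R) (d : nat).

Lemma integral_enorm_sq (Z : Om -> 'rV[R]_d) :
  (forall c, square_integrable P (fun w => Z w 0 c)) ->
  (\int[P]_w (enorm (Z w) ^+ 2)%:E = (\sum_(c < d) \int[P]_w (Z w 0%R c ^+ 2))%:E)%E.
Proof.
move=> sZ; have iZ c : P.-integrable setT (EFin \o (fun w => Z w 0 c ^+ 2)).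
  by case: (sZ c).
rewrite -(Rintegral_sum _ iZ) [RHS]fineK; last first.
  by apply: integrable_fin_num => //; exact: integrable_sum_fin.
by apply: eq_integral => w _; rewrite enorm_sq.
Qed.

(** Test against the indicator functions of events of G. *)
Lemma cond_exp0 (G : set (set Om)) (X : Om -> R) :
  <<s G>> `<=` measurable -> square_integrable P X ->
  (forall Y, measurable_wrt <<s G>> Y -> square_integrable P Y ->
    \int[P]_w (Y w * X w) = 0) ->
  is_cond_exp P <<s G>> X (cst 0).
Proof.
move=> mG sX orth; split.
- exact: sqint_integrable.
- exact: integrable_cst_fin.
- exact: measurable_wrt_cst.
move=> A GA; have mA := mG _ GA.
rewrite Rintegral_cst// mul0r.
rewrite Rintegral_mkcond -(orth (\1_A)) //.
- apply: eq_Rintegral => w _; rewrite patchE indicE.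
  by case: ifP => _; rewrite ?mul1r ?mul0r.
- exact: measurable_wrt_indic.
- apply: (@sqint_bounded _ _ _ _ _ 1); first exact: measurable_indic.
  by move=> w; rewrite indicE; case: (_ \in _); rewrite ?normr1 ?normr0.
Qed.

Lemma bigmaxe_cst0 K : (0 < K)%N ->
  \big[maxe/-oo%E]_(k < K) (0 : \bar R)%E = 0%E.
Proof.
case: K => // K _; rewrite big_const_ord.
elim: K => [|K ih]; first by rewrite /= maxeNy.
by rewrite iterS ih maxxx.
Qed.

End remainder.

Theorem lemma3p2
  (disp : measure_display) (Om : measurableType disp) (R : realType)
  (P : probability Om R) (d : nat) (d_gt0 : (0 < d)%N)
  (T : R) (T_gt0 : 0 < T)
  (f g : R -> R) (s_th : R -> 'rV[R]_d -> 'rV[R]_d)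
  (fC1 : C1_on `[0, +oo[ f) (gC1 : C1_on `[0, +oo[ g)
  (M_g : R) (g_bounded : forall t : R, 0 <= t -> `|g t| <= M_g)
  (s_cont : {within `[0, T] `*` setT,
     continuous (fun tx : R * 'rV[R]_d => s_th tx.1 tx.2)})
  (L_s : R)
  (s_lip : forall (t : R) (x y : 'rV[R]_d), t \in `[0, T] ->
     enorm (s_th t x - s_th t y) <= L_s * enorm (x - y))
  (coef_def : forall al : multi_index d, (A_set (1 : R) `|` B_set (A_set (1 : R))) al ->
     coef_exists T (drift f g s_th T) (diffusion g T) al)
  (C_A : R) (C_A_gt0 : 0 < C_A)
  (coef_lip : forall (al : multi_index d) (t : R) (x y : 'rV[R]_d), (A_set (1 : R) `|` B_set (A_set (1 : R))) al ->
     t \in `[0, T] ->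
     enorm (coef T (drift f g s_th T) (diffusion g T) al t x -
            coef T (drift f g s_th T) (diffusion g T) al t y)
       <= C_A * enorm (x - y))
  (coef_growth : forall (al : multi_index d) (t : R) (x : 'rV[R]_d), (A_set (1 : R) `|` B_set (A_set (1 : R))) al ->
     t \in `[0, T] ->
     enorm (coef T (drift f g s_th T) (diffusion g T) al t x) ^+ 2
       <= C_A ^+ 2 * (1 + enorm x ^+ 2))
  (W : R -> Om -> 'rV[R]_d) (W_wiener : is_wiener P W)
  (y0 : Om -> 'rV[R]_d) (y0_law : gaussian_vector P y0 (sigma2 f g T))
  (y0_indep : indep_sigma P <<s coord_events y0 >>
     <<s \bigcup_(t in `[0, +oo[) coord_events (W t) >>)
  (b : nat -> nat -> Om -> 'rV[R]_d)
  (b_ito : forall K k c, (k < K)%N ->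
     is_ito P (filtration y0 W) (fun t w => W t w 0 c)
       (fun s _ => Phi f T (grid T K k.+1) s * g (T - s))
       (grid T K k) (grid T K k.+1) (fun w => b K k w 0 c)) :
  general_strong_scheme P (filtration y0 W) W T
    (drift f g s_th T) (diffusion g T) 1
    (fun K => exp_integrator f g s_th T K y0 (b K)).
Proof.
have T_ge0 := ltW T_gt0.
have [C [C0 weights]] := exponential_weight_estimates T_ge0 fC1 gC1.
have [S S0 growth] := linear_growth T_ge0 s_cont s_lip.
have y0_random : random_vector y0 by case: y0_law.
have sigma0 : 0 <= sigma2 f g T.
  by apply: Rintegral_ge0 => s _; rewrite mulr_ge0 ?expR_ge0 ?sqr_ge0.
have y0_sqint c := gaussian_sqint sigma0 y0_law c.
have mF := filtration_measurable W_wiener y0_random.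
have [V V0 moments] := second_moment_bound T_gt0 C0 S0 weights s_lip growth
  W_wiener y0_random y0_indep y0_sqint b_ito.
pose CM := d%:R * (32 * C ^+ 2); pose CD := 2 * C ^+ 2 * (V + S * (1 + V)).
have CM0 : 0 <= CM.
  by apply: mulr_ge0 => //; apply: mulr_ge0 => //; exact: sqr_ge0.
have CD0 : 0 <= CD.
  apply: mulr_ge0; first by apply: mulr_ge0 => //; exact: sqr_ge0.
  by apply: addr_ge0 => //; apply: mulr_ge0 => //; exact: addr_ge0.
exists 0, (CM + CD) => K K0 h t A1.
have h0 : 0 <= h by exact: step_ge0.
have hpow (n : nat) (a : R) : a = n%:R -> h `^ a = h ^+ n.
  by move=> ->; exact: powR_mulrn.
pose y k := exp_integrator f g s_th T K y0 (b K) k.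
have y_adapted k c : (k <= K)%N ->
    measurable_wrt (filtration y0 W (t k)) (fun w => y k w 0 c).
  by move=> kK; exact: exp_integrator_adapted T_gt0 s_lip b_ito _ _ _ kK.
split; first exact: y_adapted.
have tT k : (k < K)%N -> t k < T.
  move=> kK; apply: (@lt_le_trans _ _ (t k.+1)); last exact: grid_le.
  by rewrite /t gridS ltrDl divr_gt0 ?ltr0n.
have t0 k : 0 <= t k by exact: grid_ge0.
have tS k : t k <= t k.+1 by exact: grid_leS.
pose mu := drift f g s_th T; pose sg := diffusion g T.
pose RM k w := b K k w - g (T - t k) *: (W (t k.+1) w - W (t k) w).
pose RD k w := (Phi f T (t k.+1) (t k) - 1 - h * f (T - t k)) *: y k w
  + (a_coef f g T K k - h * g (T - t k) ^+ 2) *: s_th (T - t k) (y k w).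
exists (fun al k _ w => coef T mu sg al (t k) (y k w)),
  (fun al k => frozen_integral mu sg W (y k) (t k) al), RM, RD.
split.
- move=> al k c Aal kK; split; last first.
    exact: (frozen_integralP mu sg y0 W_wiener (y k) (t0 k) (tT k kK) c (tS k) Aal).
  move=> r; rewrite in_itv/= => /andP[tr _].
  have Fr : filtration y0 W (t k) `<=` filtration y0 W r by exact: filtration_sub.
  apply: (measurable_wrtS Fr).
  apply: frozen_coef_adapted => //; first exact: tT.
  under eq_fun do rewrite !mxE.
  apply: measurable_wrtD; apply: measurable_wrtZ.
    exact: y_adapted (ltnW kK).
  exact: score_adapted T_gt0 s_lip b_ito _ _ _ kK.
- move=> al Aal err.
  have err0 : err = cst 0%E.
    apply/funext => w; rewrite /err -[RHS](@bigmaxe_cst0 R _ K0).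
    apply: eq_bigr => k _; rewrite (_ : [set _ | _ in _] = [set 0%E]) ?ereal_sup1//.
    apply/seteqP; split => [_ [r _ <-]|_ ->] /=.
      by rewrite subrr enorm_sq big1// => c _; rewrite mxE expr0n.
    exists (t k); first by rewrite /= in_itv/= lexx tS.
    by rewrite subrr enorm_sq big1// => c _; rewrite mxE expr0n.
  by rewrite err0; split; [exact: measurable_cst|rewrite integral0 mul0r].
- move=> k kK.
  have RMc c w : RM k w 0 c =
      b K k w 0 c - g (T - t k) * (W (t k.+1) w 0 c - W (t k) w 0 c).
    by rewrite !mxE.
  have sRM c : square_integrable P (fun w => RM k w 0 c).
    under eq_fun do rewrite RMc; apply: sqintB.
      by have [] := noise_moments T_gt0 C0 weights W_wiener y0_random y0_indep
        b_ito kK c.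
    apply: sqintZ.
    exact: (increment_sqint W_wiener c (t0 k) (tS k)).
  have incr c := noise_increment T_gt0 weights W_wiener y0_random y0_indep b_ito kK c.
  split.
  + by move=> c; case: (sRM c).
  + move=> c; apply: cond_exp0 => //; first exact: mF.
    move=> Y FY sY; under eq_Rintegral do rewrite RMc.
    by have [_ +] := incr c; exact.
  + rewrite integral_enorm_sq// lee_fin (hpow 3%N); last by ring.
    apply: (@le_trans _ _ (\sum_(c < d) 32 * C ^+ 2 * h ^+ 3)).
      apply: ler_sum => c _; have [+ _] := incr c.
      by under [X in _ -> X <= _]eq_Rintegral do rewrite RMc.
    rewrite sumr_const card_ord -[_ *+ d]mulr_natl mulrA -/CM.
    by rewrite ler_wpM2r ?exprn_ge0// lerDl.
- move=> k kK.
  have [sy yV] := moments K k (ltnW kK).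
  have RDc c w : RD k w 0 c =
      (Phi f T (t k.+1) (t k) - 1 - h * f (T - t k)) * y k w 0 c
      + (a_coef f g T K k - h * g (T - t k) ^+ 2) * s_th (T - t k) (y k w) 0 c.
    by rewrite !mxE.
  have [sRD RD2] := drift_remainder_bound T_gt0 C0 S0 weights s_lip growth
    W_wiener y0_random b_ito kK sy yV.
  have sRD' c : square_integrable P (fun w => RD k w 0 c).
    by under eq_fun do rewrite RDc.
  split; first by move=> c; case: (sRD' c).
  rewrite integral_enorm_sq// lee_fin (hpow 4%N); last by ring.
  apply: (@le_trans _ _ (CD * h ^+ 4)); last by rewrite ler_wpM2r ?exprn_ge0// lerDr.
  apply: le_trans RD2; rewrite le_eqVlt; apply/orP; left; apply/eqP.
  by apply: eq_bigr => c _; apply: eq_Rintegral => w _; rewrite RDc.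
- move=> k kK; apply: aeW => w.
  rewrite (sum_frozen_integral mu sg W (y k) (t k)) /t gridB.
  apply/rowP => c; rewrite /= /RM /RD /mu /drift /sg /diffusion !mxE.
  by rewrite /y /t /h; ring.
Qed.
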